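(* Consider ${\rm APP}=\{{\rm APP}_{\infty,d}\}_{d\in\mathbb N}$ in the worst case setting and fix $\star\in\{{\rm ABS},{\rm NOR}\}$. Then: (i) for each of the notions ALG-SPT, ALG-PT, ALG-QPT, ALG-WT, ALG-$(s,t)$-WT (any fixed $s,t>0$), ALG-UWT, APP has this property for $\Lambda^{\rm all}$ if and only if it has it for $\Lambda^{\rm std}$; (ii) for each of the notions EXP-SPT, EXP-PT, EXP-QPT, EXP-WT, EXP-$(s,t)$-WT (any fixed $s,t>0$), EXP-UWT, APP has this property for $\Lambda^{\rm all}$ if and only if it has it for $\Lambda^{\rm std}$; (iii) the exponents of strong polynomial tractability coincide: ${\rm ALG}\text{-}p^\star(\Lambda^{\rm all})={\rm ALG}\text{-}p^\star(\Lambda^{\rm std})$ and ${\rm EXP}\text{-}p^\star(\Lambda^{\rm all})={\rm EXP}\text{-}p^\star(\Lambda^{\rm std})$.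
   Context: $\mathbb T^d=[0,1]^d$ is the torus with Lebesgue measure; $\hat f(\mathbf k)=\int f(\mathbf x)e^{-2\pi i\mathbf k\cdot\mathbf x}d\mathbf x$. For each $d\in\mathbb N$ let $\omega_d:\mathbb Z^d\to(0,\infty)$ with $\sum_{\mathbf k}\omega_d(\mathbf k)^{-2}<\infty$, and $H^{\omega_d}(\mathbb T^d)$ the Hilbert space of $f\in L_2(\mathbb T^d)$ with $\|f\|^2=\sum_{\mathbf k}|\hat f(\mathbf k)|^2\omega_d(\mathbf k)^2<\infty$ (a reproducing kernel Hilbert space of continuous functions). ${\rm APP}_{\infty,d}:H^{\omega_d}(\mathbb T^d)\to L_\infty(\mathbb T^d)$ (sup norm), $f\mapsto f$. $\Lambda^{\rm all}$: all continuous linear functionals; $\Lambda^{\rm std}$: point evaluations. $e(n,{\rm APP}_{\infty,d};\Lambda)$: infimum over algorithms $A(f)=\phi(L_1f,\dots,L_nf)$ with $L_i\in\Lambda$, $\phi$ arbitrary, of $\sup_{\|f\|\le1}\|f-A(f)\|_\infty$; $e(0,{\rm APP}_{\infty,d})=\sup_{\|f\|\le1}\|f\|_\infty$. $n^\star(\varepsilon,d;\Lambda)=\inf\{n\ge0:e(n,{\rm APP}_{\infty,d};\Lambda)\le\varepsilon{\rm CRI}_d\}$, ${\rm CRI}_d=1$ (ABS) or $e(0,{\rm APP}_{\infty,d})$ (NOR). Below $n=n^\star(\varepsilon,d;\Lambda)$, $d\in\mathbb N$, $\varepsilon\in(0,1)$, and limits are as $\varepsilon^{-1}+d\to\infty$.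 ALG-SPT: $\exists C>0,p\ge0$ with $n\le C\varepsilon^{-p}$ for all $d,\varepsilon$; ALG-$p^\star(\Lambda)$ is the infimum of such $p$. ALG-PT: $\exists C>0,p,q\ge0$, $n\le Cd^q\varepsilon^{-p}$. ALG-QPT: $\exists C>0,t\ge0$, $n\le C\exp(t(1+\ln d)(1+\ln\varepsilon^{-1}))$. ALG-UWT: $\ln n/(\varepsilon^{-\alpha}+d^\beta)\to0$ for all $\alpha,\beta>0$. ALG-WT: $\ln n/(\varepsilon^{-1}+d)\to0$. ALG-$(s,t)$-WT: $\ln n/(\varepsilon^{-s}+d^t)\to0$. The EXP-versions are obtained by replacing $\varepsilon^{-1}$ by $1+\ln\varepsilon^{-1}$: EXP-SPT: $n\le C(1+\ln\varepsilon^{-1})^p$ (exponent EXP-$p^\star(\Lambda)$ = infimum of such $p$); EXP-PT: $n\le Cd^q(1+\ln\varepsilon^{-1})^p$; EXP-QPT: $n\le C\exp(t(1+\ln d)(1+\ln(1+\ln\varepsilon^{-1})))$; EXP-UWT: $\ln n/((1+\ln\varepsilon^{-1})^\alpha+d^\beta)\to0$ for all $\alpha,\beta>0$; EXP-WT: $\ln n/(1+\ln\varepsilon^{-1}+d)\to0$; EXP-$(s,t)$-WT: $\ln n/((1+\ln\varepsilon^{-1})^s+d^t)\to0$. *)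

(* Defs.v *)
From Stdlib Require Import Reals List ZArith.
From mathcomp Require Import ssreflect ssrfun ssrbool eqtype ssrnat fintype bigop.
From Coquelicot Require Import Coquelicot.

Set Implicit Arguments.
Unset Strict Implicit.

Local Open Scope R_scope.

Definition pt (d : nat) := 'I_d -> R.
Definition freq (d : nat) := 'I_d -> Z.

(* the torus T^d = [0,1]^d *)
Definition cube (d : nat) (x : pt d) : Prop := forall i, 0 <= x i <= 1.

Definition dotk (d : nat) (k : freq d) (x : pt d) : R :=
  \big[Rplus/0]_(i < d) (IZR (k i) * x i).

Definition cexpi (t : R) : C := (cos t, sin t).

Definition fsum {I : Type} (l : list I) (a : I -> R) : R :=
  fold_right (fun i s => a i + s) 0 l.
Definition csum {I : Type} (l : list I) (a : I -> C) : C :=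
  fold_right (fun i s => Cplus (a i) s) (RtoC 0) l.

Definition HasSum (d : nat) (a : freq d -> C) (v : C) : Prop :=
  forall eps, 0 < eps -> exists l0 : list (freq d), NoDup l0 /\
    forall l, NoDup l -> incl l0 l -> Cmod (Cminus (csum l a) v) < eps.

Definition weights := forall d : nat, freq d -> R.

Definition wterm (om : weights) (d : nat) (c : freq d -> C) (k : freq d) : R :=
  (Cmod (c k))^2 * (om d k)^2.

(* functions on T^d (extended periodically to R^d) *)
Definition fn (d : nat) := pt d -> C.

(* c is the Fourier coefficient sequence of f in H^{omega_d}:
   sum_k |c_k|^2 omega(k)^2 < oo and f(x) = sum_k c_k e^{2 pi i k.x}
   (the series converges absolutely since sum omega^{-2} < oo). *)
Definition rep (om : weights) (d : nat) (c : freq d -> C) (f : fn d) : Prop :=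
  (exists M, forall l, NoDup l -> fsum l (wterm om c) <= M) /\
  forall x : pt d, HasSum (fun k => Cmult (c k) (cexpi (2 * PI * dotk k x))) (f x).

Definition inH (om : weights) (d : nat) (f : fn d) : Prop := exists c, rep om c f.

Definition ball (om : weights) (d : nat) (f : fn d) : Prop :=
  exists c, rep om c f /\ forall l, NoDup l -> fsum l (wterm om c) <= 1.

Definition norm_lt (om : weights) (d : nat) (f : fn d) (r : R) : Prop :=
  exists c, rep om c f /\ exists eta, eta < r^2 /\
    forall l, NoDup l -> fsum l (wterm om c) <= eta.

Definition fn_sub (d : nat) (f g : fn d) : fn d := fun x => Cminus (f x) (g x).
Definition fn_lin (d : nat) (a b : C) (f g : fn d) : fn d :=
  fun x => Cplus (Cmult a (f x)) (Cmult b (g x)).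

(* linear functionals (only their values on H^{omega_d} matter) *)
Definition functional (d : nat) := fn d -> C.

Definition info_class := forall (om : weights) (d : nat), functional d -> Prop.

Definition Lall : info_class := fun om d L =>
  (forall (a b : C) f g, inH om f -> inH om g ->
      L (fn_lin a b f g) = Cplus (Cmult a (L f)) (Cmult b (L g))) /\
  (forall f, inH om f -> forall eps, 0 < eps -> exists delta, 0 < delta /\
      forall g, inH om g -> norm_lt om (fn_sub f g) delta ->
        Cmod (Cminus (L f) (L g)) < eps).

Definition Lstd : info_class := fun om d L =>
  exists x : pt d, cube x /\ forall f, L f = f x.

Definition box (d : nat) (a b : pt d) (x : pt d) : Prop :=
  forall i, a i <= x i <= b i.
Definition vol (d : nat) (a b : pt d) : R := \big[Rmult/1]_(i < d) (b i - a i).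

Definition null (d : nat) (N : pt d -> Prop) : Prop :=
  forall eps, 0 < eps -> exists a b : nat -> pt d,
    (forall j i, a j i <= b j i) /\
    (forall x, N x -> exists j, box (a j) (b j) x) /\
    (forall m, \big[Rplus/0]_(j < m) vol (a j) (b j) <= eps).

Inductive borel (d : nat) : (pt d -> Prop) -> Prop :=
| borel_box a b : borel (box a b)
| borel_compl E : borel E -> borel (fun x => ~ E x)
| borel_union (E : nat -> pt d -> Prop) :
    (forall n, borel (E n)) -> borel (fun x => exists n, E n x)
| borel_ext E F : borel E -> (forall x, E x <-> F x) -> borel F.

Definition lmeas (d : nat) (E : pt d -> Prop) : Prop :=
  exists B N, borel B /\ null N /\ (forall x, ~ (E x <-> B x) -> N x).

Definition measurable_fn (d : nat) (g : fn d) : Prop :=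
  forall a : R,
    lmeas (fun x => cube x /\ a < fst (g x)) /\
    lmeas (fun x => cube x /\ a < snd (g x)).

Definition ess_sup (d : nat) (h : fn d) : Rbar :=
  Glb_Rbar (fun M => null (fun x => cube x /\ M < Cmod (h x))).

Definition Linf (d : nat) (g : fn d) : Prop :=
  measurable_fn g /\ ess_sup g <> p_infty.

Definition wc_err (om : weights) (d n : nat) (L : 'I_n -> functional d)
    (phi : ('I_n -> C) -> fn d) : Rbar :=
  Rbar_lub (fun v => exists f, ball om f /\
              v = ess_sup (fn_sub f (phi (fun i => L i f)))).

Definition err (Lam : info_class) (om : weights) (d n : nat) : Rbar :=
  Rbar_glb (fun v => exists (L : 'I_n -> functional d) (phi : ('I_n -> C) -> fn d),
     (forall i, Lam om d (L i)) /\ (forall y, Linf (phi y)) /\ v = wc_err om L phi).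

Definition init_err (om : weights) (d : nat) : Rbar :=
  Rbar_lub (fun v => exists f : fn d, ball om f /\ v = ess_sup f).

Inductive setting := ABS | NOR.

Definition CRI (s : setting) (om : weights) (d : nat) : Rbar :=
  match s with ABS => Finite 1 | NOR => init_err om d end.

Definition is_nstar (Lam : info_class) (s : setting) (om : weights)
    (eps : R) (d n : nat) : Prop :=
  Rbar_le (err Lam om d n) (Rbar_mult (Finite eps) (CRI s om d)) /\
  forall m, (m < n)%nat -> ~ Rbar_le (err Lam om d m) (Rbar_mult (Finite eps) (CRI s om d)).

Definition u_alg (eps : R) : R := / eps.
Definition u_exp (eps : R) : R := 1 + ln (/ eps).

Definition admissible (d : nat) (eps : R) : Prop := (1 <= d)%nat /\ 0 < eps < 1.

Section Notions.
Variables (u : R -> R) (Lam : info_class) (s : setting) (om : weights).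

Definition SPT_with (p : R) : Prop :=
  exists C, 0 < C /\ forall d eps, admissible d eps ->
    exists n, is_nstar Lam s om eps d n /\ INR n <= C * Rpower (u eps) p.

Definition SPT : Prop := exists p, 0 <= p /\ SPT_with p.

Definition pstar : Rbar := Glb_Rbar (fun p => 0 <= p /\ SPT_with p).

Definition PT : Prop :=
  exists C p q, 0 < C /\ 0 <= p /\ 0 <= q /\ forall d eps, admissible d eps ->
    exists n, is_nstar Lam s om eps d n /\
      INR n <= C * Rpower (INR d) q * Rpower (u eps) p.

Definition QPT : Prop :=
  exists C t, 0 < C /\ 0 <= t /\ forall d eps, admissible d eps ->
    exists n, is_nstar Lam s om eps d n /\
      INR n <= C * exp (t * (1 + ln (INR d)) * (1 + ln (u eps))).

(* ln n*(eps,d) / g(eps,d) -> 0 as eps^{-1} + d -> oo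
   (n* = oo counts as failure; ln 0 = 0 by Stdlib's convention) *)
Definition ln_nstar_small (g : R -> nat -> R) : Prop :=
  forall delta, 0 < delta -> exists K, forall d eps, admissible d eps ->
    K < / eps + INR d ->
    exists n, is_nstar Lam s om eps d n /\ ln (INR n) <= delta * g eps d.

Definition WT : Prop := ln_nstar_small (fun eps d => u eps + INR d).

Definition stWT (sp tp : R) : Prop :=
  ln_nstar_small (fun eps d => Rpower (u eps) sp + Rpower (INR d) tp).

Definition UWT : Prop :=
  forall al be, 0 < al -> 0 < be ->
    ln_nstar_small (fun eps d => Rpower (u eps) al + Rpower (INR d) be).

End Notions.

Definition admissible_weights (om : weights) : Prop :=
  forall d, (forall k, 0 < om d k) /\
    exists M, forall l : list (freq d), NoDup l -> fsum l (fun k => / (om d k)^2) <= M.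

(* Main.v *)
(** Write [lam k = om k ^ -2].

    Lower bound for arbitrary linear information: averaging the reproducing kernel
    of the common kernel of [n] functionals over a grid shows that an error [r] forces
    a set [K] of at most [2 n + 1] frequencies outside of which [lam] sums to [O(r^2)].

    Upper bound for sampling: along a line [j * theta], a frequency [h] becomes an angle
    [t h] on the circle.  Let [E] be the normalised Dirichlet kernel with [M ~ n] terms,
    so that [|E|^2] is a Fejer kernel of mean [1 / M].  For most directions a given [k] in
    [K] is well separated from the rest of [K]; by conditional expectations, [O(log n)]
    directions suffice to make every [k] well separated in three quarters of them.
    If [f - g = sum_h a_h e_h] vanishes at the nodes, then [sum_h a_h E(t h - t k)^4 = 0].
    Bombieri's inequality bounds the column sums of [|E|^4] over well separated [k] by [5/4],
    whence [sum_K |a_k| <= 5 sum_(h not in K) |a_h|], and Cauchy-Schwarz gives an error [O(r)].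

    Thus [n*(eps; std) = O(m log m)] with [m = n*(eps / 36; all) + 1], and the logarithm and the
    constant are invisible to all the tractability notions and to the exponents. *)
Require Import Defs.
From Stdlib Require Import Reals List ZArith Lra Lia Permutation Classical ClassicalEpsilon FunctionalExtensionality.
From HB Require Import structures.
From mathcomp Require Import ssreflect ssrfun ssrbool eqtype ssrnat choice fintype finfun bigop.
From Coquelicot Require Import Coquelicot.
Set Implicit Arguments.
Unset Strict Implicit.
Local Open Scope R_scope.

(** Both errors are governed by the sum of [lam] outside [K]. The reproducing kernel has a constant
    diagonal, so averages over points are traces; and the sup norm is at most the [l1] norm of the
    coefficients, which Cauchy-Schwarz bounds off [K] by the square root of that sum.

    Why a fourth power: Bombieri's inequality bounds sums of squared inner products, and the Fejer
    kernel is itself an inner product, so [|E|^4] is what it controls. The identity for [f - g] must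
    be linear in nodal values, and [E^4] is a trigonometric polynomial with exponents from [0] to
    [4 (M - 1)].

    Why several directions: with [M ~ n], a single direction may separate a fixed proportion of [K]
    badly. Excluding this by a union bound needs [M ~ n^2], which would determine the exponents of
    strong tractability only up to a factor two. With logarithmically many directions the budget is
    [O(n^(1 + delta))] for every [delta > 0].

    Errors are essential suprema and the outputs of algorithms need not be continuous, so the lower
    bound compares [f] with [- f] and requires that nondegenerate boxes are not null. *)

HB.instance Definition _ :=
  Monoid.isComLaw.Build R 0 Rplus (fun x y z => esym (Rplus_assoc x y z)) Rplus_comm Rplus_0_l.
HB.instance Definition _ :=
  Monoid.isComLaw.Build R 1 Rmult (fun x y z => esym (Rmult_assoc x y z)) Rmult_comm Rmult_1_l.

(** * Finite sums over lists *)

Section FiniteSums.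
Context {I : Type}.
Implicit Types (l : list I) (a b : I -> R) (u v : I -> C).

Lemma fsum_ext l a b : (forall i, In i l -> a i = b i) -> fsum l a = fsum l b.
Proof.
elim: l => [//|i l IH] H /=; rewrite H /=; last by left.
by rewrite IH // => j Hj; apply: H; right.
Qed.

Lemma fsum_le l a b : (forall i, In i l -> a i <= b i) -> fsum l a <= fsum l b.
Proof.
elim: l => [|i l IH] H /=; first lra.
have := H i (or_introl erefl); have := IH (fun j Hj => H j (or_intror Hj)); lra.
Qed.

Lemma fsum_const l c : fsum l (fun _ => c) = INR (length l) * c.
Proof. elim: l => [|i l IH]; first by rewrite /=; ring. by rewrite [length _]/= S_INR /= IH; ring. Qed.

Lemma fsum0 l : fsum l (fun _ => 0) = 0.
Proof. by rewrite fsum_const; ring. Qed.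

Lemma fsum_ge0 l a : (forall i, In i l -> 0 <= a i) -> 0 <= fsum l a.
Proof. by move=> H; rewrite -(fsum0 l); apply: fsum_le. Qed.

Lemma fsum_plus l a b : fsum l (fun i => a i + b i) = fsum l a + fsum l b.
Proof. by elim: l => [|i l IH] /=; rewrite ?IH; ring. Qed.

Lemma fsum_minus l a b : fsum l (fun i => a i - b i) = fsum l a - fsum l b.
Proof. by elim: l => [|i l IH] /=; rewrite ?IH; ring. Qed.

Lemma fsum_scal l c a : fsum l (fun i => c * a i) = c * fsum l a.
Proof. by elim: l => [|i l IH] /=; rewrite ?IH; ring. Qed.

Lemma fsum_app l1 l2 a : fsum (l1 ++ l2) a = fsum l1 a + fsum l2 a.
Proof. by elim: l1 => [|i l IH] /=; rewrite ?IH; ring. Qed.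

Lemma fsum_perm l1 l2 a : Permutation l1 l2 -> fsum l1 a = fsum l2 a.
Proof. by elim=> [|x l l' _ IH|x y l|l l' l'' _ -> _ ->] //=; rewrite ?IH; ring. Qed.

Lemma fsum_filter l (p : I -> bool) a :
  fsum (List.filter p l) a = fsum l (fun i => if p i then a i else 0).
Proof. by elim: l => [//|i l IH] /=; case: (p i) => /=; rewrite IH; ring. Qed.

Lemma fsum_term_le l a i : (forall j, In j l -> 0 <= a j) -> In i l -> a i <= fsum l a.
Proof.
elim: l => [//|j l IH] H /= [->|Hi].
  have := fsum_ge0 (fun j Hj => H j (or_intror Hj)); lra.
have := IH (fun j Hj => H j (or_intror Hj)) Hi; have := H j (or_introl erefl); lra.
Qed.

Lemma csum_ext l u v : (forall i, In i l -> u i = v i) -> csum l u = csum l v.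
Proof.
elim: l => [//|i l IH] H /=; rewrite H /=; last by left.
by rewrite IH // => j Hj; apply: H; right.
Qed.

Lemma csum0 l : csum l (fun _ => RtoC 0) = RtoC 0.
Proof. by elim: l => [//|i l IH] /=; rewrite IH; ring. Qed.

Lemma csum_plus l u v : csum l (fun i => Cplus (u i) (v i)) = Cplus (csum l u) (csum l v).
Proof. by elim: l => [|i l IH] /=; rewrite ?IH; ring. Qed.

Lemma csum_scal l c u : csum l (fun i => Cmult c (u i)) = Cmult c (csum l u).
Proof. by elim: l => [|i l IH] /=; rewrite ?IH; ring. Qed.

Lemma csum_app l1 l2 u : csum (l1 ++ l2) u = Cplus (csum l1 u) (csum l2 u).
Proof. by elim: l1 => [|i l IH] /=; rewrite ?IH; ring. Qed.

Lemma csum_perm l1 l2 u : Permutation l1 l2 -> csum l1 u = csum l2 u.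
Proof. by elim=> [|x l l' _ IH|x y l|l l' l'' _ -> _ ->] //=; rewrite ?IH; ring. Qed.

Lemma csum_conj l u : csum l (fun i => Cconj (u i)) = Cconj (csum l u).
Proof.
elim: l => [|i l IH] /=; first by rewrite /Cconj /RtoC /= Ropp_0.
by rewrite IH /Cconj /Cplus /=; congr pair; ring.
Qed.

Lemma csum_RtoC l a : csum l (fun i => RtoC (a i)) = RtoC (fsum l a).
Proof. by elim: l => [//|i l IH] /=; rewrite IH RtoC_plus. Qed.

Lemma Re_csum l u : fst (csum l u) = fsum l (fun i => fst (u i)).
Proof. by elim: l => [//|i l IH] /=; rewrite IH. Qed.

Lemma Cmod_csum l u : Cmod (csum l u) <= fsum l (fun i => Cmod (u i)).
Proof.
elim: l => [|i l IH] /=; first by rewrite Cmod_0; lra.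
have := Cmod_triangle (u i) (csum l u); lra.
Qed.

(* Isolating the [i]-th term of the sum and adding it once more on the right
   avoids sums over the index set minus a point. *)
Lemma Cmod_term_le l u i : In i l ->
  2 * Cmod (u i) <= Cmod (csum l u) + fsum l (fun j => Cmod (u j)).
Proof.
move=> /(@in_split I) [l1 [l2 ->]].
have P := Permutation_sym (Permutation_middle l1 l2 i).
rewrite (csum_perm u P) (fsum_perm _ P) /=.
have E : u i = Cminus (Cplus (u i) (csum (l1 ++ l2) u)) (csum (l1 ++ l2) u) by ring.
have := Cmod_triangle (Cplus (u i) (csum (l1 ++ l2) u)) (Copp (csum (l1 ++ l2) u)).
rewrite Cmod_opp -/(Cminus _ _) -E; have := Cmod_csum (l1 ++ l2) u; lra.
Qed.

Lemma perm_complement (K l : list I) : NoDup K -> incl K l -> exists l', Permutation l (K ++ l').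
Proof.
elim: K l => [|k K IH] l; first by move=> _ _; exists l.
move=> /NoDup_cons_iff [kK nK] sub.
have /(@in_split I) [l1 [l2 El]] := sub k (or_introl erefl).
have P : Permutation l (k :: (l1 ++ l2)).
  by rewrite El; apply: Permutation_sym; apply: Permutation_middle.
have [|l' P'] := IH (l1 ++ l2) nK.
  move=> x Hx; have := Permutation_in x P (sub x (or_intror Hx)); case=> // E.
  by case: kK; rewrite E.
by exists l'; apply: (Permutation_trans P) => /=; apply: perm_skip.
Qed.

Lemma fsum_incl (l1 l2 : list I) a : NoDup l1 -> incl l1 l2 -> (forall i, In i l2 -> 0 <= a i) ->
  fsum l1 a <= fsum l2 a.
Proof.
move=> n1 sub H; have [l' P] := perm_complement n1 sub.
rewrite (fsum_perm a P) fsum_app.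
have : 0 <= fsum l' a.
  apply: fsum_ge0 => i Hi; apply: H; apply: (Permutation_in _ (Permutation_sym P)).
  by apply: in_or_app; right.
lra.
Qed.

Lemma cauchy_schwarz l a b :
  (fsum l (fun i => a i * b i))^2 <= fsum l (fun i => a i ^ 2) * fsum l (fun i => b i ^ 2).
Proof.
elim: l => [|i l IH] /=; first lra.
move: IH; set s := fsum l _; set A := fsum l _; set B := fsum l _ => IH.
have A0 : 0 <= A by apply: fsum_ge0 => j _; apply: pow2_ge_0.
have B0 : 0 <= B by apply: fsum_ge0 => j _; apply: pow2_ge_0.
set x := a i; set y := b i.
have : 2 * (x * y * s) <= x^2 * B + y^2 * A.
  have [p Ep] : exists p, p^2 = A by exists (sqrt A); rewrite pow2_sqrt.
  have [q Eq] : exists q, q^2 = B by exists (sqrt B); rewrite pow2_sqrt.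
  rewrite -Ep -Eq in IH *.
  have H : Rabs s <= Rabs (p * q).
    by apply: Rsqr_le_abs_0; rewrite /Rsqr; nra.
  have H1 : Rabs (x * y * s) <= Rabs (x * q * (y * p)).
    rewrite Rabs_mult (_ : x * q * (y * p) = (x * y) * (p * q)); last ring.
    by rewrite (Rabs_mult (x*y) (p*q)); apply: Rmult_le_compat_l => //; apply: Rabs_pos.
  have := Rle_abs (x * y * s).
  have : 2 * Rabs (x * q * (y * p)) <= (x*q)^2 + (y*p)^2.
    by rewrite /Rabs; case: Rcase_abs => _; [have := pow2_ge_0 (x*q + y*p)|have := pow2_ge_0 (x*q-y*p)]; nra.
  nra.
nra.
Qed.

End FiniteSums.

Lemma fsum_swap {I J : Type} (l : list I) (m : list J) (a : I -> J -> R) :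
  fsum l (fun i => fsum m (a i)) = fsum m (fun j => fsum l (a^~ j)).
Proof.
elim: l => [|i l IH] /=; first by rewrite fsum0.
by rewrite IH -fsum_plus.
Qed.

Lemma csum_swap {I J : Type} (l : list I) (m : list J) (a : I -> J -> C) :
  csum l (fun i => csum m (a i)) = csum m (fun j => csum l (a^~ j)).
Proof.
elim: l => [|i l IH] /=; first by rewrite csum0.
by rewrite IH -csum_plus.
Qed.

Lemma fsum_map {I J : Type} (f : I -> J) l (a : J -> R) : fsum (List.map f l) a = fsum l (fun i => a (f i)).
Proof. by elim: l => [//|i l IH] /=; rewrite IH. Qed.

Lemma csum_map {I J : Type} (f : I -> J) l (a : J -> C) : csum (List.map f l) a = csum l (fun i => a (f i)).
Proof. by elim: l => [//|i l IH] /=; rewrite IH. Qed.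

Lemma csum_prod {I J : Type} (l : list I) (m : list J) (u : I -> C) (v : J -> C) :
  csum (list_prod l m) (fun p => Cmult (u (fst p)) (v (snd p))) = Cmult (csum l u) (csum m v).
Proof.
elim: l => [|i l IH] /=; first by ring.
by rewrite csum_app csum_map IH /= csum_scal; ring.
Qed.

Lemma fsum_bigop {I : Type} (l : list I) (a : I -> R) : \big[Rplus/0]_(i <- l) a i = fsum l a.
Proof. by elim: l => [|i l IH]; rewrite ?big_nil ?big_cons ?IH. Qed.

(** * Waves and unconditional sums *)

Lemma cexpi_plus s t : cexpi (s + t) = Cmult (cexpi s) (cexpi t).
Proof. by rewrite /cexpi /Cmult /= cos_plus sin_plus; congr pair; ring. Qed.

Lemma cexpi0 : cexpi 0 = RtoC 1.
Proof. by rewrite /cexpi cos_0 sin_0. Qed.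

Lemma cexpi_opp t : cexpi (- t) = Cconj (cexpi t).
Proof. by rewrite /cexpi /Cconj /= cos_neg sin_neg. Qed.

Lemma Cmod_cexpi t : Cmod (cexpi t) = 1.
Proof.
rewrite -sqrt_1 /Cmod /cexpi /=; apply: f_equal.
have := sin2_cos2 t; rewrite /Rsqr; lra.
Qed.

Lemma cexpi_period n : cexpi (2 * PI * IZR n) = RtoC 1.
Proof.
have P (m : nat) : cexpi (2 * PI * INR m) = RtoC 1.
  rewrite /cexpi /RtoC (_ : 2 * PI * INR m = 0 + 2 * INR m * PI); last ring.
  by rewrite cos_period sin_period cos_0 sin_0.
case: (Z_le_gt_dec 0 n) => Hn.
  by rewrite -(Z2Nat.id n) // -INR_IZR_INZ.
rewrite (_ : 2 * PI * IZR n = - (2 * PI * INR (Z.to_nat (- n)))).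
  by rewrite cexpi_opp P /Cconj /RtoC /= Ropp_0.
by rewrite INR_IZR_INZ Z2Nat.id ?opp_IZR; [ring|lia].
Qed.

Lemma Rabs_sin_le x : Rabs (sin x) <= Rabs x.
Proof.
have P y : 0 <= y -> Rabs (sin y) <= y.
  move=> Hy; have [|Hy1] := Rle_or_lt 1 y.
    by have := SIN_bound y; rewrite /Rabs; case: Rcase_abs; lra.
  have [Hy0|E] := Hy; last by rewrite -E sin_0 Rabs_R0; lra.
  have := PI2_1; have := sin_lt_x y Hy0; have := sin_ge_0 y Hy => H1 H2 H3.
  rewrite Rabs_pos_eq; lra.
have [H|H] := Rle_or_lt 0 x; first by rewrite (Rabs_pos_eq x) //; apply: P.
have := P (- x) ltac:(lra); rewrite sin_neg Rabs_Ropp (Rabs_left x) //; lra.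
Qed.

(** A chord of the unit circle is the rotation to the midpoint times [2 i sin] of half the angle. *)
Lemma cexpi_lipschitz s t : Cmod (Cminus (cexpi s) (cexpi t)) <= 2 * Rabs (s - t).
Proof.
have E : Cminus (cexpi s) (cexpi t) =
    Cmult (cexpi ((s + t) / 2)) (0, 2 * sin ((s - t) / 2)).
  have H a b : Cminus (cexpi (a + b)) (cexpi (a - b)) = Cmult (cexpi a) (0, 2 * sin b).
    rewrite /Rminus !cexpi_plus cexpi_opp /cexpi /Cmult /Cconj /Cminus /Cplus /Copp /=.
    by congr pair; ring.
  by rewrite -H; congr (Cminus (cexpi _) (cexpi _)); field.
rewrite E Cmod_mult Cmod_cexpi /Cmod /= Rmult_1_l.
rewrite (_ : 0 * (0 * 1) + _ = Rsqr (2 * sin ((s - t) / 2))); last by rewrite /Rsqr; ring.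
rewrite sqrt_Rsqr_abs Rabs_mult (Rabs_pos_eq 2); last lra.
have := Rabs_sin_le ((s - t) / 2); rewrite /Rdiv Rabs_mult (Rabs_pos_eq (/ 2)); last lra.
have := Rabs_pos (s - t); lra.
Qed.

Definition wave (d : nat) (k : freq d) (x : pt d) : C := cexpi (2 * PI * dotk k x).

Definition disjoint_lists {I : Type} (l m : list I) : Prop := forall x, In x l -> ~ In x m.

Definition sums_le {I : Type} (a : I -> R) (B : R) : Prop := forall l, NoDup l -> fsum l a <= B.

Lemma NoDup_union {I : Type} (l m : list I) :
  exists n, NoDup n /\ incl l n /\ incl m n.
Proof.
exists (nodup (fun x y => excluded_middle_informative (x = y)) (l ++ m)).
split; first exact: NoDup_nodup.
by split=> x Hx; apply: (proj2 (nodup_In _ _ _)); apply: in_or_app; auto.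
Qed.

Lemma perm_disjoint_complement {I : Type} (K l : list I) :
  NoDup K -> NoDup l -> incl K l ->
  exists l', [/\ Permutation l (K ++ l'), NoDup l' & disjoint_lists l' K].
Proof.
move=> nK nl sub; have [l' P] := perm_complement nK sub.
have N := Permutation_NoDup P nl.
exists l'; split=> //; first exact: NoDup_app_remove_l N.
move=> x Hl HK; have [l1 [l2 E]] := in_split _ _ Hl.
rewrite E app_assoc in N; apply: (NoDup_remove_2 _ _ _ N).
by apply: in_or_app; left; apply: in_or_app; left.
Qed.

(** A list whose sum comes within [e] of the supremum of all finite sums leaves at most [e] to any
    list disjoint from it. *)
Lemma sums_le_tail {I : Type} (a : I -> R) (B e : R) :
  (forall i, 0 <= a i) -> sums_le a B -> 0 < e ->
  exists l0, NoDup l0 /\ forall r, NoDup r -> disjoint_lists r l0 -> fsum r a <= e.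
Proof.
move=> a0 HB e0.
pose E x := exists l, NoDup l /\ x = fsum l a.
have [s [ub lub]] : {s | is_lub E s}.
  apply: completeness; last by exists 0, nil; split=> //; constructor.
  by exists B => x [l [nl ->]]; apply: HB.
have [l0 [n0 H0]] : exists l0, NoDup l0 /\ s - e < fsum l0 a.
  apply: NNPP => H; have : s <= s - e; last lra.
  apply: lub => x [l [nl ->]]; apply: Rnot_lt_le => Hl; apply: H; by exists l.
exists l0; split=> // r nr dis.
have : fsum (l0 ++ r) a <= s.
  apply: ub; exists (l0 ++ r); split=> //.
  by apply: NoDup_app => // x Hx Hr; apply: (dis x).
rewrite fsum_app; lra.
Qed.

Section HasSum.
Context {d : nat}.
Implicit Types (a b : freq d -> C) (v w : C).

Lemma HasSum_plus a b v w :
  HasSum a v -> HasSum b w -> HasSum (fun k => Cplus (a k) (b k)) (Cplus v w).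
Proof.
move=> Ha Hb e e0; have [la [_ Pa]] := Ha (e / 2) ltac:(lra); have [lb [_ Pb]] := Hb (e / 2) ltac:(lra).
have [l0 [n0 [ia ib]]] := NoDup_union la lb.
exists l0; split=> // l nl sub.
have := Pa l nl (fun x Hx => sub x (ia x Hx)); have := Pb l nl (fun x Hx => sub x (ib x Hx)) => H1 H2.
rewrite csum_plus (_ : Cminus _ _ = Cplus (Cminus (csum l a) v) (Cminus (csum l b) w)); last ring.
have := Cmod_triangle (Cminus (csum l a) v) (Cminus (csum l b) w); lra.
Qed.

Lemma HasSum_scal c a v : HasSum a v -> HasSum (fun k => Cmult c (a k)) (Cmult c v).
Proof.
move=> Ha e e0; have c0 := Cmod_ge_0 c; have c1 : 0 < Cmod c + 1 by lra.
have [la [na Pa]] := Ha (e / (Cmod c + 1)) (Rdiv_lt_0_compat _ _ e0 c1).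
exists la; split=> // l nl sub; have H := Pa l nl sub.
rewrite csum_scal (_ : Cminus _ _ = Cmult c (Cminus (csum l a) v)); last ring.
rewrite Cmod_mult; have X := Cmod_ge_0 (Cminus (csum l a) v).
have : e = e / (Cmod c + 1) * (Cmod c + 1) by field; lra.
nra.
Qed.

Lemma HasSum_csum {I : Type} (q : list I) (a : I -> freq d -> C) (v : I -> C) :
  (forall i, In i q -> HasSum (a i) (v i)) ->
  HasSum (fun k => csum q (fun i => a i k)) (csum q v).
Proof.
elim: q => [|i q IH] H /=.
  move=> e e0; exists nil; split; first by constructor.
  by move=> l _ _; rewrite csum0 (_ : Cminus _ _ = RtoC 0) ?Cmod_0 //; ring.
by apply: HasSum_plus; [apply: H; left|apply: IH => j Hj; apply: H; right].
Qed.

Lemma HasSum_finite (F : list (freq d)) a : NoDup F -> (forall k, ~ In k F -> a k = RtoC 0) ->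
  HasSum a (csum F a).
Proof.
move=> nF H e e0; exists F; split=> // l nl sub.
have [l' [P _ dis]] := perm_disjoint_complement nF nl sub.
rewrite (csum_perm a P) csum_app (csum_ext (l := l') (v := fun _ => RtoC 0)).
  by rewrite csum0 (_ : Cminus _ _ = RtoC 0) ?Cmod_0 //; ring.
by move=> k Hk; apply: H; apply: dis.
Qed.

(** One finite list truncates finitely many unconditional sums at once, which lets the recovery
    argument run on finite sums only. Containing [K] keeps the frequencies to be recovered in the
    truncation. *)
Lemma HasSum_approx {I : Type} (q : list I) (a : I -> freq d -> C) (v : I -> C) K e :
  (forall i, In i q -> HasSum (a i) (v i)) -> 0 < e ->
  exists l, [/\ NoDup l, incl K l & forall i, In i q -> Cmod (Cminus (csum l (a i)) (v i)) < e].
Proof.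
move=> H e0.
suff [l0 P] : exists l0, forall l, NoDup l -> incl l0 l ->
    forall i, In i q -> Cmod (Cminus (csum l (a i)) (v i)) < e.
  have [l [nl [i0 iK]]] := NoDup_union l0 K.
  by exists l; split=> //; apply: P.
elim: q H => [|i q IH] H; first by exists nil.
have [l1 [_ P1]] := H i (or_introl erefl) e e0.
have [l2 P2] := IH (fun j Hj => H j (or_intror Hj)).
exists (l1 ++ l2) => l nl sub j [<-|Hj].
  by apply: P1 => // x Hx; apply: sub; apply: in_or_app; left.
by apply: P2 => // x Hx; apply: sub; apply: in_or_app; right.
Qed.

Lemma HasSum_bound a v K e : HasSum a v -> NoDup K ->
  (forall r, NoDup r -> disjoint_lists r K -> fsum r (fun k => Cmod (a k)) <= e) ->
  Cmod (Cminus v (csum K a)) <= e.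
Proof.
move=> Ha nK Hr; apply: le_epsilon => t t0.
have [||l [nl sub P]] := @HasSum_approx unit (tt :: nil) (fun _ => a) (fun _ => v) K t => //.
have [l' [Pl nl' dis]] := perm_disjoint_complement nK nl sub.
have := P tt (or_introl erefl); rewrite (csum_perm a Pl) csum_app => H.
rewrite (_ : Cminus v _ = Cplus (csum l' a) (Copp (Cminus (Cplus (csum K a) (csum l' a)) v))); last ring.
apply: (Rle_trans _ _ _ (Cmod_triangle _ _)); rewrite Cmod_opp.
have := Cmod_csum l' a; have := Hr l' nl' dis; lra.
Qed.

End HasSum.

Lemma Cmod_wave d (k : freq d) x : Cmod (wave k x) = 1.
Proof. exact: Cmod_cexpi. Qed.

Lemma dotk_fsum d (k : freq d) x : dotk k x = fsum (index_enum 'I_d) (fun i => IZR (k i) * x i).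
Proof. exact: fsum_bigop. Qed.

Lemma wave_lipschitz d (k : freq d) : exists L, 0 <= L /\
  forall x y del, (forall i, Rabs (x i - y i) <= del) -> Cmod (Cminus (wave k x) (wave k y)) <= L * del.
Proof.
exists (4 * PI * fsum (index_enum 'I_d) (fun i => Rabs (IZR (k i)))); have P0 := PI_RGT_0.
have S0 : 0 <= fsum (index_enum 'I_d) (fun i => Rabs (IZR (k i))).
  by apply: fsum_ge0 => i _; apply: Rabs_pos.
split=> [|x y del H]; first by nra.
apply: (Rle_trans _ _ _ (cexpi_lipschitz _ _)).
rewrite -Rmult_minus_distr_l Rabs_mult (Rabs_pos_eq (2 * PI)); last lra.
have : Rabs (dotk k x - dotk k y) <= fsum (index_enum 'I_d) (fun i => Rabs (IZR (k i))) * del.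
  rewrite !dotk_fsum; elim: (index_enum _) => [|i l IH] /=; first by rewrite Rminus_diag Rabs_R0; lra.
  set A := fsum l _; set B := fsum l _; set S := fsum l _.
  rewrite (_ : _ - _ = (IZR (k i) * (x i - y i)) + (A - B)); last by ring.
  apply: (Rle_trans _ _ _ (Rabs_triang _ _)); rewrite Rabs_mult.
  have := H i; have := Rabs_pos (IZR (k i)); have : Rabs (A - B) <= S * del := IH; nra.
nra.
Qed.

(** * Nondegenerate boxes are not null *)

Lemma bigprod_ge0 {I : Type} (l : list I) (P : pred I) (F : I -> R) :
  (forall i, 0 <= F i) -> 0 <= \big[Rmult/1]_(i <- l | P i) F i.
Proof. by move=> H; apply: (big_ind (fun x => 0 <= x)) => [|x y|i _]; [lra|exact: Rmult_le_pos|exact: H]. Qed.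

Lemma bigprod_gt0 {I : Type} (l : list I) (F : I -> R) :
  (forall i, 0 < F i) -> 0 < \big[Rmult/1]_(i <- l) F i.
Proof. by move=> H; apply: (big_ind (fun x => 0 < x)) => [|x y|i _]; [lra|exact: Rmult_lt_0_compat|exact: H]. Qed.

Lemma bigprod_le {I : Type} (l : list I) (F G : I -> R) :
  (forall i, 0 <= F i <= G i) -> \big[Rmult/1]_(i <- l) F i <= \big[Rmult/1]_(i <- l) G i.
Proof.
move=> H; elim: l => [|i l IH]; rewrite ?big_nil ?big_cons; first lra.
have [H0 H1] := H i; apply: Rmult_le_compat => //.
by apply: bigprod_ge0 => j; have [] := H j.
Qed.

Lemma bigsum_le {n : nat} (F G : 'I_n -> R) :
  (forall i, F i <= G i) -> \big[Rplus/0]_(i < n) F i <= \big[Rplus/0]_(i < n) G i.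
Proof. by move=> H; rewrite !fsum_bigop; apply: fsum_le. Qed.

Lemma bigsum_nat_mono (F : nat -> R) m n : (forall j, 0 <= F j) -> (m <= n)%nat ->
  \big[Rplus/0]_(j < m) F j <= \big[Rplus/0]_(j < n) F j.
Proof.
move=> H /subnK <-; elim: (n - m)%nat => [|k IH]; first by rewrite add0n; lra.
by rewrite addSn big_ord_recr; move: IH (H (k + m)%nat) => /=; lra.
Qed.

Definition overlap (p q r s : R) : R := Rmax 0 (Rmin q s - Rmax p r).

Ltac overlap_cases :=
  rewrite /overlap /Rmin /Rmax;
  repeat match goal with
  | |- context [Rle_dec ?x ?y] =>
    lazymatch x with context [Rle_dec _ _] => fail | _ =>
    lazymatch y with context [Rle_dec _ _] => fail | _ => case: (Rle_dec x y) => ? end end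
  end; lra.

Section Boxes.
Context {d : nat}.
Implicit Types (a b : pt d).

Definition upd a (i : 'I_d) (c : R) : pt d := fun j => if j == i then c else a j.

(* volume of the intersection of the boxes [a, b] and [a', b'] *)
Definition capvol a b a' b' : R := \big[Rmult/1]_(i < d) overlap (a i) (b i) (a' i) (b' i).

Lemma overlap_ge0 p q r s : 0 <= overlap p q r s.
Proof. exact: Rmax_l. Qed.

Lemma overlap_le p q r s : r <= s -> overlap p q r s <= s - r.
Proof. by move=> *; overlap_cases. Qed.

Lemma overlap_sub p q r s : p <= q -> r <= p -> q <= s -> overlap p q r s = q - p.
Proof. by move=> *; overlap_cases. Qed.

Lemma overlap_split p c q r s : p <= c <= q ->
  overlap p q r s = overlap p c r s + overlap c q r s.
Proof. by move=> *; overlap_cases. Qed.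

Lemma capvol_ge0 a b a' b' : 0 <= capvol a b a' b'.
Proof. by apply: bigprod_ge0 => i; apply: overlap_ge0. Qed.

Lemma capvol_le a b a' b' : (forall i, a' i <= b' i) -> capvol a b a' b' <= vol a' b'.
Proof. by move=> H; apply: bigprod_le => i; split; [apply: overlap_ge0|apply: overlap_le]. Qed.

Lemma capvol_sub a b a' b' : (forall i, a i <= b i) -> (forall i, a' i <= a i) ->
  (forall i, b i <= b' i) -> capvol a b a' b' = vol a b.
Proof. by move=> H1 H2 H3; apply: eq_bigr => i _; apply: overlap_sub. Qed.

Lemma capvol_split a b a' b' i c : a i <= c <= b i ->
  capvol a b a' b' = capvol a (upd b i c) a' b' + capvol (upd a i c) b a' b'.
Proof.
move=> H; rewrite /capvol !(bigD1 (P := predT) i) //= /upd eqxx (overlap_split _ _ H).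
rewrite Rmult_plus_distr_r; congr (_ * _ + _ * _);
  by apply: eq_bigr => j /negbTE ->.
Qed.

Lemma vol_split a b i c :
  vol a b = vol a (upd b i c) + vol (upd a i c) b.
Proof.
rewrite /vol !(bigD1 (P := predT) i) //= /upd eqxx.
rewrite (_ : b i - a i = (c - a i) + (b i - c)); last ring.
rewrite Rmult_plus_distr_r; congr (_ * _ + _ * _);
  by apply: eq_bigr => j /negbTE ->.
Qed.

(** The enlarged volume is a polynomial in the margin, hence continuous at [0]. The margin puts a
    neighbourhood of every covered point inside an enlarged box. *)
Lemma vol_enlarge a b eta : 0 < eta ->
  exists del, 0 < del /\ vol (fun i => a i - del) (fun i => b i + del) <= vol a b + eta.
Proof.
move=> eta0; pose g t := vol (fun i => a i - t) (fun i => b i + t).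
have cg : continuity_pt g 0.
  rewrite /g /vol; elim: (index_enum _) => [|i l IH].
    apply: (continuity_pt_ext (fun _ => 1)); first by move=> t; rewrite big_nil.
    by apply: continuity_pt_const => x y.
  pose h t := \big[Rmult/1]_(i <- l) (b i + t - (a i - t)).
  apply: (continuity_pt_ext (fun t => (b i + t - (a i - t)) * h t)).
    by move=> t; rewrite big_cons.
  by apply: continuity_pt_mult => //; reg.
have [al [al0 H]] := cg eta eta0.
exists (al / 2); split; first lra.
have /H : D_x no_cond 0 (al / 2) /\ R_dist (al / 2) 0 < al.
  by split; [split=> //; lra|rewrite /R_dist Rminus_0_r Rabs_pos_eq; lra].
rewrite /dist /= /R_dist => H1; have := Rle_abs (g (al / 2) - g 0).
have -> : vol a b = g 0; last by rewrite -/(g _); lra.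
by apply: eq_bigr => i _; ring.
Qed.

(* The box [a, b] has more volume than the boxes [A j, B j] cover; bisection
   preserves this in at least one half. *)
Definition undercovered (A B : nat -> pt d) a b : Prop :=
  forall m, \big[Rplus/0]_(j < m) capvol a b (A j) (B j) <= vol a b / 2.

Lemma undercovered_halve A B a b i : (forall j, a j < b j) -> undercovered A B a b ->
  exists a' b', [/\ undercovered A B a' b', forall j, a j <= a' j, forall j, b' j <= b j,
    b' i - a' i = (b i - a i) / 2 & forall j, j != i -> a' j = a j /\ b' j = b j].
Proof.
move=> ab H; have abi := ab i; set c := (a i + b i) / 2; have abc : a i <= c <= b i by rewrite /c; lra.
suff [P|P] : undercovered A B a (upd b i c) \/ undercovered A B (upd a i c) b.
- exists a, (upd b i c); split=> //.
  + by move=> j; lra.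
  + by move=> j; rewrite /upd; case: eqP => [->|_]; [rewrite /c|]; lra.
  + by rewrite /upd eqxx /c; field.
  + by move=> j /negbTE E; rewrite /upd E.
- exists (upd a i c), b; split=> //.
  + by move=> j; rewrite /upd; case: eqP => [->|_]; [rewrite /c|]; lra.
  + by move=> j; lra.
  + by rewrite /upd eqxx /c; field.
  + by move=> j /negbTE E; rewrite /upd E.
apply: NNPP => /not_or_and [N1 N2].
have [m1 H1] := not_all_ex_not _ _ N1; have [m2 H2] := not_all_ex_not _ _ N2.
have M1 := bigsum_nat_mono (fun j => capvol_ge0 a (upd b i c) (A j) (B j)) (leq_maxl m1 m2).
have M2 := bigsum_nat_mono (fun j => capvol_ge0 (upd a i c) b (A j) (B j)) (leq_maxr m1 m2).
have := H (maxn m1 m2); rewrite (vol_split a b i c).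
rewrite (eq_bigr (fun j : 'I_(maxn m1 m2) => capvol a (upd b i c) (A j) (B j) +
  capvol (upd a i c) b (A j) (B j)) (fun j _ => capvol_split _ _ abc)) big_split.
by move: M1 M2 H1 H2 => /=; lra.
Qed.

(** Cutting one coordinate at a time keeps every choice between two halves; later cuts leave the
    sides already halved untouched. *)
Lemma undercovered_halve_all A B a b : (forall j, a j < b j) -> undercovered A B a b ->
  exists a' b', [/\ undercovered A B a' b', forall j, a j <= a' j, forall j, b' j <= b j &
    forall j, b' j - a' j = (b j - a j) / 2].
Proof.
move=> ab H.
suff G (l : list 'I_d) : NoDup l -> exists a' b',
    [/\ undercovered A B a' b', forall j, a j <= a' j, forall j, b' j <= b j,
      forall j, In j l -> b' j - a' j = (b j - a j) / 2 &
      forall j, ~ In j l -> a' j = a j /\ b' j = b j].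
  have [a' [b' [h1 h2 h3 h4 _]]] := G _ (NoDup_nodup (fun x y => excluded_middle_informative (x = y)) (enum 'I_d)).
  exists a', b'; split=> // j; apply: h4; apply: (proj2 (nodup_In _ _ _)).
  have := mem_enum 'I_d j; rewrite inE; elim: (enum _) => [//|k s IH].
  by rewrite seq.inE => /orP [/eqP ->|/IH]; [left|right].
elim: l => [|i l IH].
  by move=> _; exists a, b; split=> // j; lra.
move=> /NoDup_cons_iff [il /IH [a1 [b1 [h1 h2 h3 h4 h5]]]].
have ab1 j : a1 j < b1 j.
  have := ab j; case: (classic (In j l)) => [/h4|/h5 [-> ->]]; lra.
have [a' [b' [k1 k2 k3 k4 k5]]] := undercovered_halve i ab1 h1.
exists a', b'; split=> //.
- by move=> j; have := h2 j; have := k2 j; lra.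
- by move=> j; have := h3 j; have := k3 j; lra.
- move=> j /= [<-|jl]; first by rewrite k4; have [-> ->] := h5 i il.
  have ji : j != i by apply/eqP => E; apply: il; rewrite -E.
  by have [-> ->] := k5 j ji; apply: h4.
- move=> j /= /not_or_and [ij jl].
  have ji : j != i by apply/eqP => E; apply: ij.
  by have [-> ->] := k5 j ji; apply: h5.
Qed.

(** Repeated halving gives nested boxes whose corners converge to a common point. This replaces the
    compactness of the box. *)
Lemma undercovered_point A B a b : (forall j, a j < b j) -> undercovered A B a b ->
  exists x, box a b x /\ forall del, 0 < del -> exists a' b',
    [/\ undercovered A B a' b', forall j, a' j < b' j, forall j, x j - del <= a' j
      & forall j, b' j <= x j + del].
Proof.
move=> ab H.
(* Bundling a box with its invariants makes the halving step a total map that can be iterated. *)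
pose T := {q : pt d * pt d | (forall j, fst q j < snd q j) /\ undercovered A B (fst q) (snd q)}.
pose next (p q : T) := forall j, [/\ fst (sval p) j <= fst (sval q) j,
  snd (sval q) j <= snd (sval p) j &
  snd (sval q) j - fst (sval q) j = (snd (sval p) j - fst (sval p) j) / 2].
have ex p : exists q, next p q.
  case: p => -[a1 b1] [/= h1 h2].
  have [a' [b' [k1 k2 k3 k4]]] := undercovered_halve_all h1 h2.
  have h : (forall j, a' j < b' j) /\ undercovered A B a' b'.
    by split=> // j; have := h1 j; have := k4 j; lra.
  by exists (exist _ (a', b') h) => j /=.
pose f p := sval (constructive_indefinite_description _ (ex p)).
have Pf p : next p (f p) := svalP (constructive_indefinite_description _ (ex p)).
pose s n := iter n f (exist _ (a, b) (conj ab H) : T).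
pose l n := fst (sval (s n)); pose r n := snd (sval (s n)).
have inc n j : l n j <= l n.+1 j by have [] := Pf (s n) j.
have dec n j : r n.+1 j <= r n j by have [] := Pf (s n) j.
have len n j : r n j - l n j = (b j - a j) * (1 / 2) ^ n.
  elim: n => [|n IH]; first by rewrite /r /l /=; ring.
  by have [_ _ E] := Pf (s n) j; rewrite /r /l [s _.+1]/= E -/(r n) -/(l n) IH /=; field.
have lr n j : l n j < r n j by have := svalP (s n); case=> /(_ j).
have mono m n j : (m <= n)%nat -> l m j <= l n j.
  by move=> /subnK <-; elim: (n - m)%nat => [|k IH]; [rewrite add0n; lra|rewrite addSn; have := inc (k+m)%nat j; lra].
have anti m n j : (m <= n)%nat -> r n j <= r m j.
  by move=> /subnK <-; elim: (n - m)%nat => [|k IH]; [rewrite add0n; lra|rewrite addSn; have := dec (k+m)%nat j; lra].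
have cross m n j : l m j <= r n j.
  have := mono m (maxn m n) j (leq_maxl m n); have := anti n (maxn m n) j (leq_maxr m n).
  have := lr (maxn m n) j; lra.
have sup j : {x | is_lub (fun y => exists n, y = l n j) x}.
  apply: completeness; last by exists (l 0%nat j), 0%nat.
  by exists (r 0%nat j) => y [n ->].
pose x : pt d := fun j => sval (sup j).
have xl n j : l n j <= x j by have [h _] := svalP (sup j); apply: h; exists n.
have xr n j : x j <= r n j by have [_ h] := svalP (sup j); apply: h => y [m ->].
exists x; split; first by move=> j; split; [exact: (xl 0%nat)|exact: (xr 0%nat)].
move=> del del0.
pose w := fsum (enum 'I_d) (fun j => b j - a j).
have w0 : 0 <= w by apply: fsum_ge0 => j _; have := ab j; lra.
have hw j : b j - a j <= w.
  apply: (@fsum_term_le _ _ (fun j => b j - a j)) => [k _|]; first by have := ab k; lra.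
  have := mem_enum 'I_d j; rewrite inE; elim: (enum _) => [//|k e IH].
  by rewrite seq.inE => /orP [/eqP ->|/IH]; [left|right].
have [||n Hn] := pow_lt_1_zero (1/2) _ (del / (w + 1)).
  by rewrite Rabs_pos_eq; lra.
  by apply: Rdiv_lt_0_compat; lra.
have {Hn} := Hn n (le_n n); set p := (1/2)^n => Hn.
have p0 : 0 < p by apply: pow_lt; lra.
rewrite Rabs_pos_eq in Hn; last lra.
have Hd : w * p <= del.
  have : del = del / (w + 1) * (w + 1) by field; lra.
  nra.
exists (l n), (r n); split.
- by have := svalP (s n); case.
- by move=> j; apply: lr.
- by move=> j; have := xr n j; have := len n j; have := hw j; rewrite -/p; nra.
- by move=> j; have := xl n j; have := len n j; have := hw j; rewrite -/p; nra.
Qed.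

(** Enlarge the boxes of a cover of volume at most a quarter of [vol a b]. Near the limit point of
    the bisection, a small undercovered box lies inside one enlarged box, which covers all of its
    volume instead of at most half. *)
Lemma box_not_null a b : (forall j, a j < b j) -> ~ null (box a b).
Proof.
move=> ab N; have v0 : 0 < vol a b by apply: bigprod_gt0 => i; have := ab i; lra.
have [A [B [AB [cov S]]]] := N (vol a b / 4) ltac:(lra).
(* The geometric margins add at most another quarter of [vol a b], so the enlarged boxes stay within
   the half allowed by [undercovered]. *)
have en j := @vol_enlarge (A j) (B j) (vol a b / 4 * (1/2)^(j.+1)) ltac:(apply: Rmult_lt_0_compat; [lra|apply: pow_lt; lra]).
pose del j := sval (constructive_indefinite_description _ (en j)).
have Pdel j := svalP (constructive_indefinite_description _ (en j)); rewrite -/(del _) in Pdel.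
pose A' j : pt d := fun i => A j i - del j; pose B' j : pt d := fun i => B j i + del j.
have U : undercovered A' B' a b.
  move=> m; apply: (Rle_trans _ (\big[Rplus/0]_(j < m) (vol (A j) (B j) + vol a b / 4 * (1/2)^(j.+1)))).
    apply: bigsum_le => j; have [dj Hj] := Pdel j.
    apply: (Rle_trans _ _ _ (capvol_le _ _ _)) => // i.
    by rewrite /A' /B' -/(del _) in dj *; have := AB j i; lra.
  rewrite big_split; have Sm := S m.
  have S2 : \big[Rplus/0]_(i < m) (vol a b / 4 * (1/2) ^ i.+1) <= vol a b / 4 * (1 - (1/2)^m).
    elim: m {Sm} => [|m IH]; first by rewrite big_ord0 /=; lra.
    by rewrite big_ord_recr /=; move: IH => /=; lra.
  have S3 : 0 < vol a b / 4 * (1/2)^m by apply: Rmult_lt_0_compat; [lra|apply: pow_lt; lra].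
  by move: Sm S2 S3 => /=; lra.
have [x [bx Px]] := undercovered_point ab U.
have [j Bj] := cov x bx; have [dj _] := Pdel j.
have [a' [b' [U' ab' h1 h2]]] := Px (del j) dj.
have Uj := U' j.+1; rewrite big_ord_recr (capvol_sub (a := a')) /= in Uj.
- have Z : 0 <= \big[Rplus/0]_(i < j) capvol a' b' (A' i) (B' i).
    by rewrite fsum_bigop; apply: fsum_ge0 => i _; apply: capvol_ge0.
  have V : 0 < vol a' b' by apply: bigprod_gt0 => i; have := ab' i; lra.
  by move: Z Uj => /=; lra.
- by move=> i; have := ab' i; lra.
- by move=> i; rewrite /A'; have := h1 i; have := Bj i; lra.
- by move=> i; rewrite /B'; have := h2 i; have := Bj i; lra.
Qed.

End Boxes.

(** * Null sets, measurability and the essential supremum *)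

Lemma null_sub d (N N' : pt d -> Prop) : (forall x, N' x -> N x) -> null N -> null N'.
Proof.
move=> H HN e e0; have [a [b [h1 [h2 h3]]]] := HN e e0.
by exists a, b; split=> //; split=> // x /H; apply: h2.
Qed.

Lemma vol_point d (a : pt d) : (1 <= d)%nat -> vol a a = 0.
Proof. by case: d a => [//|d] a _; rewrite /vol big_ord_recl Rminus_diag Rmult_0_l. Qed.

Lemma vol_ge0 d (a b : pt d) : (forall i, a i <= b i) -> 0 <= vol a b.
Proof. by move=> H; apply: bigprod_ge0 => i; have := H i; lra. Qed.

(** For [d = 0] every box has volume [1], an empty product, so not even the empty set is null; hence
    [1 <= d]. *)
Lemma null_empty d : (1 <= d)%nat -> null (fun _ : pt d => False).
Proof.
move=> d1 e e0; exists (fun _ _ => 0), (fun _ _ => 0); split; first by move=> *; lra.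
split=> // m; rewrite fsum_bigop (fsum_ext (b := fun _ => 0)); first by rewrite fsum0; lra.
by move=> i _; apply: vol_point.
Qed.

Lemma bigsum_interleave (u v : nat -> R) m :
  \big[Rplus/0]_(j < m.*2) (if odd j then v j./2 else u j./2) =
  \big[Rplus/0]_(j < m) u j + \big[Rplus/0]_(j < m) v j.
Proof.
elim: m => [|m IH]; first by rewrite !big_ord0; lra.
rewrite doubleS !big_ord_recr /= odd_double /= uphalf_double doubleK.
by move: IH => /= ->; ring.
Qed.

Lemma null_union d (N N' : pt d -> Prop) : null N -> null N' -> null (fun x => N x \/ N' x).
Proof.
move=> H H' e e0.
have [a [b [h1 [h2 h3]]]] := H (e / 2) ltac:(lra).
have [a' [b' [k1 [k2 k3]]]] := H' (e / 2) ltac:(lra).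
exists (fun j => if odd j then a' j./2 else a j./2), (fun j => if odd j then b' j./2 else b j./2).
split; first by move=> j i; case: (odd j).
split=> [x [/h2 [j Hj]|/k2 [j Hj]]|m].
- by exists j.*2; rewrite odd_double doubleK.
- by exists (j.*2).+1; rewrite /= odd_double /= uphalf_double.
pose w j := if odd j then vol (a' j./2) (b' j./2) else vol (a j./2) (b j./2).
have w0 j : 0 <= w j by rewrite /w; case: (odd j); apply: vol_ge0.
have E : forall j, vol (if odd j then a' j./2 else a j./2) (if odd j then b' j./2 else b j./2) = w j.
  by rewrite /w => j; case: (odd j).
have mm : (m <= m.*2)%nat by rewrite -addnn leq_addr.
have := bigsum_nat_mono w0 mm.
rewrite (bigsum_interleave (fun j => vol (a j) (b j)) (fun j => vol (a' j) (b' j))).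
rewrite (eq_bigr (fun j : 'I_m => w j) (fun j _ => E j)).
by have := h3 m; have := k3 m; move=> /=; lra.
Qed.

Lemma borel_inter d (E F : pt d -> Prop) : borel E -> borel F -> borel (fun x => E x /\ F x).
Proof.
move=> hE hF.
pose G (n : nat) x := if n is 0%nat then ~ E x else ~ F x.
have hG n : borel (G n) by case: n => [|n]; apply: borel_compl.
apply: (borel_ext (borel_compl (borel_union hG))) => x; split.
  by move=> H; split; apply: NNPP => h; apply: H; [exists 0%nat|exists 1%nat].
by move=> [h1 h2] [[|n]].
Qed.

Lemma borel_empty d : borel (fun _ : pt d => False).
Proof.
apply: (borel_ext (borel_inter (borel_box (fun _ => 0) (fun _ => 1))
  (borel_compl (borel_box (fun _ : 'I_d => 0) (fun _ => 1))))) => x.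
by split=> // -[].
Qed.

Lemma Rfloor_nat x : 0 <= x -> exists p : nat, INR p <= x < INR p + 1.
Proof.
move=> x0; have [h1 h2] := archimed x.
have u0 : (0 < up x)%Z by apply: lt_IZR; lra.
exists (Z.to_nat (up x - 1)); rewrite INR_IZR_INZ Z2Nat.id; last by lia.
rewrite minus_IZR; lra.
Qed.

(* The grid cells of mesh sizes 1/(n+1) inside an open set, enumerated by [unpickle], exhaust it. *)
Lemma borel_cube_open d (S : pt d -> Prop) :
  (forall x, S x -> exists del, 0 < del /\ forall y, (forall i, Rabs (x i - y i) <= del) -> S y) ->
  borel (fun x => cube x /\ S x).
Proof.
move=> oS.
pose lo (q : nat * {ffun 'I_d -> nat}) : pt d := fun i => INR (snd q i) / INR (fst q).+1.
pose hi (q : nat * {ffun 'I_d -> nat}) : pt d := fun i => (INR (snd q i) + 1) / INR (fst q).+1.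
pose cell n x := exists q, [/\ unpickle n = Some q, box (lo q) (hi q) x
  & forall y, box (lo q) (hi q) y -> S y].
have bcell n : borel (cell n).
  case Eq : (unpickle n : option (nat * {ffun 'I_d -> nat})) => [q|]; last first.
    apply: (borel_ext (@borel_empty d)) => x; split=> // -[q []]; by rewrite Eq.
  case: (classic (forall y, box (lo q) (hi q) y -> S y)) => Hq.
    apply: (borel_ext (borel_box (lo q) (hi q))) => x; split; first by exists q.
    by case=> q' []; rewrite Eq => -[<-].
  apply: (borel_ext (@borel_empty d)) => x; split=> // -[q' []].
  by rewrite Eq => -[<-].
apply: (borel_ext (borel_inter (borel_box (fun _ => 0) (fun _ => 1)) (borel_union bcell))) => x.
split; first by case=> cx [n [q [_ bq Hq]]]; split=> //; apply: Hq.
case=> cx Sx; split=> //.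
have [del [d0 Hd]] := oS x Sx.
have [n Hn] : exists n, / INR n.+1 < del.
  have [n [Hn n0]] := archimed_cor1 del d0.
  exists n.-1; rewrite prednK //; by apply/ltP.
have n1 : 0 < INR n.+1 by apply: lt_0_INR; lia.
have fl i : exists p : nat, INR p <= x i * INR n.+1 < INR p + 1.
  by apply: Rfloor_nat; have := cx i; nra.
pose q : nat * {ffun 'I_d -> nat} :=
  (n, [ffun i => sval (constructive_indefinite_description _ (fl i))]).
have Pq i : INR (snd q i) <= x i * INR n.+1 < INR (snd q i) + 1.
  by rewrite /q /= ffunE; apply: (svalP (constructive_indefinite_description _ (fl i))).
exists (pickle q), q; split; first exact: pickleK.
  move=> i; have := Pq i; rewrite /lo /hi; set p := INR _ => -[h1 h2].
  split; first by apply/Rle_div_l => //; lra.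
  by apply/Rle_div_r => //; rewrite /= in h1 h2 *; lra.
move=> y Hy; apply: Hd => i; have := Hy i; have := Pq i.
rewrite /lo /hi; set p := INR _; rewrite [fst q]/=; set m := INR n.+1 => -[h1 h2] [h3 h4].
have k1 : p / m <= x i by apply/Rle_div_l => //; lra.
have k2 : x i <= (p + 1) / m by apply/Rle_div_r => //; lra.
have : (p + 1) / m = p / m + / m by field; rewrite /m; lra.
rewrite -/m in Hn; rewrite /Rabs; case: Rcase_abs; lra.
Qed.

Definition unif_cont d (f : fn d) : Prop := forall eps, 0 < eps -> exists del, 0 < del /\
  forall x y, (forall i, Rabs (x i - y i) <= del) -> Cmod (Cminus (f x) (f y)) < eps.

Lemma Rabs_fst_Cmod z : Rabs (fst z) <= Cmod z.
Proof. by have := Rmax_Cmod z; have := Rmax_l (Rabs (fst z)) (Rabs (snd z)); lra. Qed.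

Lemma Rabs_snd_Cmod z : Rabs (snd z) <= Cmod z.
Proof. by have := Rmax_Cmod z; have := Rmax_r (Rabs (fst z)) (Rabs (snd z)); lra. Qed.

Lemma unif_cont_measurable d (f : fn d) : (1 <= d)%nat -> unif_cont f -> measurable_fn f.
Proof.
move=> d1 uf a.
suff G (p : C -> R) : (forall z w, Rabs (p z - p w) <= Cmod (Cminus z w)) ->
    lmeas (fun x => cube x /\ a < p (f x)).
  split; apply: (G); move=> z w; [have := Rabs_fst_Cmod (Cminus z w)|have := Rabs_snd_Cmod (Cminus z w)];
    by rewrite /Cminus /Cplus /Copp.
move=> Hp; exists (fun x => cube x /\ a < p (f x)), (fun _ => False); split; last first.
  by split; [exact: null_empty|move=> x; apply].
apply: borel_cube_open => x Hx.
have [del [d0 Hd]] := uf (p (f x) - a) ltac:(lra).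
exists del; split=> // y /Hd; have := Hp (f x) (f y); have := Rle_abs (p (f x) - p (f y)); lra.
Qed.

Lemma ess_sup_le d (h : fn d) M : (1 <= d)%nat -> (forall x, cube x -> Cmod (h x) <= M) ->
  Rbar_le (ess_sup h) M.
Proof.
move=> d1 H; have [lb _] := Glb_Rbar_correct (fun M => null (fun x => cube x /\ M < Cmod (h x))).
apply: lb; apply: null_sub (null_empty d1) => x [cx]; have := H x cx; lra.
Qed.

Lemma ess_sup_null d (h : fn d) r M : Rbar_le (ess_sup h) (Finite r) -> r < M ->
  null (fun x => cube x /\ M < Cmod (h x)).
Proof.
move=> H rM; have [_ glb] := Glb_Rbar_correct (fun M => null (fun x => cube x /\ M < Cmod (h x))).
have [M' [N HM]] : exists M', null (fun x => cube x /\ M' < Cmod (h x)) /\ M' < M.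
  apply: NNPP => no; have : Rbar_le M r; last by move=> /=; lra.
  apply: Rbar_le_trans H; apply: glb => M' N; rewrite /=; apply: Rnot_lt_le => h'; apply: no; by exists M'.
by apply: null_sub N => x [cx h']; split=> //; lra.
Qed.

(** [f] and [- f] share the approximation [p], and [2 |f|] is at most the sum of the two errors. If
    [|f x0| > r], uniform continuity makes one of the errors too large at each point of a whole box,
    which is not null. *)
Lemma ess_sup_symmetric d (f p : fn d) r x0 : unif_cont f -> cube x0 ->
  Rbar_le (ess_sup (fn_sub f p)) (Finite r) ->
  Rbar_le (ess_sup (fn_sub (fun x => Copp (f x)) p)) (Finite r) ->
  Cmod (f x0) <= r.
Proof.
move=> uf c0 H1 H2; apply: Rnot_lt_le => Hr.
set e := (Cmod (f x0) - r) / 2; have e0 : 0 < e by rewrite /e; lra.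
have N := null_union (ess_sup_null (M := r + e) H1 ltac:(lra)) (ess_sup_null (M := r + e) H2 ltac:(lra)).
have [del [d0 Hd]] := uf e e0.
(* Clipped to the cube, the box stays nondegenerate even for [x0] on the boundary. *)
apply: (@box_not_null d (fun i => Rmax 0 (x0 i - del)) (fun i => Rmin 1 (x0 i + del))).
  by move=> i; have := c0 i; rewrite /Rmax /Rmin; repeat case: Rle_dec => ?; lra.
apply: null_sub N => x bx.
have cx : cube x.
  move=> i; have := bx i; have := Rmax_l 0 (x0 i - del); have := Rmin_l 1 (x0 i + del); lra.
have : Cmod (Cminus (f x0) (f x)) < e.
  apply: Hd => i; have := bx i; have := Rmax_r 0 (x0 i - del); have := Rmin_r 1 (x0 i + del).
  rewrite /Rabs; case: Rcase_abs; lra.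
have T : Cmod (f x0) <= Cmod (Cminus (f x0) (f x)) + Cmod (f x).
  by have := Cmod_triangle (Cminus (f x0) (f x)) (f x); rewrite (_ : Cplus _ _ = f x0) //; ring.
move=> H3; have H4 : r + e < Cmod (f x) by rewrite /e in H3 *; lra.
apply: NNPP => /not_or_and [n1 n2].
have h1 : Cmod (fn_sub f p x) <= r + e by apply: Rnot_lt_le => h; apply: n1.
have h2 : Cmod (fn_sub (fun x => Copp (f x)) p x) <= r + e by apply: Rnot_lt_le => h; apply: n2.
have : 2 * Cmod (f x) <= Cmod (fn_sub f p x) + Cmod (fn_sub (fun x => Copp (f x)) p x).
  rewrite /fn_sub -(Cmod_opp (Cminus (Copp _) _)).
  apply: Rle_trans (Cmod_triangle _ _).
  rewrite (_ : Cplus _ _ = Cmult (RtoC 2) (f x)); last by rewrite /Cminus; ring.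
  by rewrite Cmod_mult Cmod_R Rabs_pos_eq; lra.
lra.
Qed.

(** * The weighted Hilbert space *)

Lemma rep_ext om d (c c' : freq d -> C) f f' : (forall k, c k = c' k) -> (forall x, f x = f' x) ->
  rep om c f -> rep om c' f'.
Proof. by move=> /functional_extensionality <- /functional_extensionality <-. Qed.

Section Space.
Context (om : weights).
Arguments om : clear implicits.
Context (d : nat) (om0 : forall k, 0 < om d k).
Implicit Types (c : freq d -> C) (f g : fn d).

Definition lam (k : freq d) : R := / (om d k)^2.

Lemma lam_gt0 k : 0 < lam k.
Proof. by apply: Rinv_0_lt_compat; apply: pow_lt. Qed.

Lemma wterm_ge0 c k : 0 <= wterm om c k.
Proof. by rewrite /wterm; have := pow2_ge_0 (Cmod (c k)); have := pow2_ge_0 (om d k); nra. Qed.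

Lemma wterm_add c c' k :
  wterm om (fun k => Cplus (c k) (c' k)) k <= 2 * wterm om c k + 2 * wterm om c' k.
Proof.
rewrite /wterm; have := Cmod_triangle (c k) (c' k); have := pow2_ge_0 (om d k).
set x := Cmod (c k); set y := Cmod (c' k); set z := Cmod _; set w := om d k ^ 2 => w0 H.
have : z^2 <= 2 * x^2 + 2 * y^2.
  have := pow2_ge_0 (x - y); have z0 : 0 <= z by apply: Cmod_ge_0.
  nra.
nra.
Qed.

Lemma wterm_scal a c k : wterm om (fun k => Cmult a (c k)) k = (Cmod a)^2 * wterm om c k.
Proof. by rewrite /wterm Cmod_mult; ring. Qed.

Lemma sum_coef_le c l B T : fsum l (wterm om c) <= B -> fsum l lam <= T ->
  fsum l (fun k => Cmod (c k)) <= sqrt (B * T).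
Proof.
move=> HB HT.
rewrite (fsum_ext (b := fun k => (Cmod (c k) * om d k) * / om d k)); last first.
  by move=> k _; field; have := om0 k; lra.
have cs := cauchy_schwarz l (fun k => Cmod (c k) * om d k) (fun k => / om d k).
set s := fsum l _ in cs *.
have s1 : fsum l (fun k => (Cmod (c k) * om d k)^2) = fsum l (wterm om c).
  by apply: fsum_ext => k _; rewrite /wterm; ring.
have s2 : fsum l (fun k => (/ om d k)^2) = fsum l lam.
  by apply: fsum_ext => k _; rewrite /lam pow_inv.
rewrite s1 s2 in cs.
have p1 : 0 <= fsum l (wterm om c) by apply: fsum_ge0 => k _; apply: wterm_ge0.
have p2 : 0 <= fsum l lam by apply: fsum_ge0 => k _; have := lam_gt0 k; lra.
apply: Rle_trans (Rle_abs s) _; rewrite -sqrt_Rsqr_abs; apply: sqrt_le_1_alt; rewrite /Rsqr; nra.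
Qed.

Lemma coef_summable c M B : sums_le lam M -> sums_le (wterm om c) B ->
  sums_le (fun k => Cmod (c k)) (sqrt (B * M)).
Proof. by move=> HM HB l nl; apply: sum_coef_le; [apply: HB|apply: HM]. Qed.

Lemma rep_bound c f M B x : sums_le lam M -> sums_le (wterm om c) B -> rep om c f ->
  Cmod (f x) <= sqrt (B * M).
Proof.
move=> HM HB [_ Hf].
have := HasSum_bound (e := sqrt (B * M)) (Hf x) (NoDup_nil _); rewrite (_ : Cminus _ _ = f x); last by rewrite /=; ring.
apply=> r nr _; rewrite (fsum_ext (b := fun k => Cmod (c k))).
  exact: coef_summable HM HB r nr.
by move=> k _; rewrite Cmod_mult Cmod_cexpi Rmult_1_r.
Qed.

(** The tail of the absolutely convergent series is uniformly small, and the finite part is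
    Lipschitz. *)
Lemma rep_unif_cont c f M : sums_le lam M -> rep om c f -> unif_cont f.
Proof.
move=> HM [[B HB] Hf] e e0.
have [|||l0 [n0 H0]] := @sums_le_tail _ (fun k => Cmod (c k)) (sqrt (B * M)) (e / 4).
- by move=> k; apply: Cmod_ge_0.
- exact: coef_summable HM HB.
- lra.
have Ht x : Cmod (Cminus (f x) (csum l0 (fun k => Cmult (c k) (wave k x)))) <= e / 4.
  apply: (HasSum_bound (Hf x) n0) => r nr dis.
  rewrite (fsum_ext (b := fun k => Cmod (c k))); first exact: H0.
  by move=> k _; rewrite Cmod_mult Cmod_cexpi Rmult_1_r.
have [L [L0 HL]] : exists L, 0 <= L /\ forall x y del, (forall i, Rabs (x i - y i) <= del) ->
    Cmod (Cminus (csum l0 (fun k => Cmult (c k) (wave k x))) (csum l0 (fun k => Cmult (c k) (wave k y))))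
      <= L * del.
  elim: (l0) => [|k l [L [L0 HL]]].
    by exists 0; split=> [|x y del _] /=; [lra|rewrite (_ : Cminus _ _ = RtoC 0) ?Cmod_0; [lra|ring]].
  have [L' [L'0 HL']] := wave_lipschitz k.
  exists (Cmod (c k) * L' + L); split=> [|x y del H /=]; first by have := Cmod_ge_0 (c k); nra.
  have h1 := HL x y del H; have h2 := HL' x y del H.
  rewrite (_ : Cminus _ _ = Cplus (Cmult (c k) (Cminus (wave k x) (wave k y)))
    (Cminus (csum l (fun k => Cmult (c k) (wave k x))) (csum l (fun k => Cmult (c k) (wave k y))))); last by ring.
  apply: (Rle_trans _ _ _ (Cmod_triangle _ _)); rewrite Cmod_mult.
  by have := Cmod_ge_0 (c k); nra.
have L1 : 0 < L + 1 by lra.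
exists (e / (4 * (L + 1))); split; first by apply: Rdiv_lt_0_compat; lra.
move=> x y H; have h1 := HL x y _ H; have h2 := Ht x; have h3 := Ht y.
set X := csum l0 _ in h1 h2; set Y := csum l0 _ in h1 h3.
rewrite (_ : Cminus _ _ = Cplus (Cminus (f x) X) (Cplus (Cminus X Y) (Copp (Cminus (f y) Y)))); last by ring.
have t1 := Cmod_triangle (Cminus (f x) X) (Cplus (Cminus X Y) (Copp (Cminus (f y) Y))).
have t2 := Cmod_triangle (Cminus X Y) (Copp (Cminus (f y) Y)); rewrite Cmod_opp in t2.
have : L * (e / (4 * (L + 1))) <= e / 4.
  rewrite (_ : L * (e / (4 * (L + 1))) = e / 4 * (L / (L + 1))); last by field; lra.
  have : L / (L + 1) <= 1 by apply: (proj2 (Rle_div_l L 1 (L + 1) L1)); lra.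
  have : 0 < e / 4 by lra.
  nra.
lra.
Qed.

Lemma rep_Linf c f M : (1 <= d)%nat -> sums_le lam M -> rep om c f -> Linf f.
Proof.
move=> d1 HM Hf; split; first exact: unif_cont_measurable d1 (rep_unif_cont HM Hf).
have [[B HB] _] := Hf.
have := ess_sup_le (h := f) (M := sqrt (B * M)) d1 (fun x _ => rep_bound x HM HB Hf).
by move=> H E; rewrite E in H.
Qed.

Lemma rep_lin a b c c' f g : rep om c f -> rep om c' g ->
  rep om (fun k => Cplus (Cmult a (c k)) (Cmult b (c' k))) (fn_lin a b f g).
Proof.
move=> [[B HB] Hf] [[B' HB'] Hg]; split.
  exists (2 * (Cmod a ^ 2 * B) + 2 * (Cmod b ^ 2 * B')) => l nl.
  apply: (Rle_trans _ (fsum l (fun k => 2 * (Cmod a ^ 2 * wterm om c k) + 2 * (Cmod b ^ 2 * wterm om c' k)))).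
    apply: fsum_le => k _; rewrite -!wterm_scal; exact: wterm_add.
  rewrite fsum_plus !fsum_scal; have := HB l nl; have := HB' l nl.
  have := pow2_ge_0 (Cmod a); have := pow2_ge_0 (Cmod b); nra.
move=> x; have := HasSum_plus (HasSum_scal a (Hf x)) (HasSum_scal b (Hg x)).
by congr HasSum; apply: functional_extensionality => k; ring.
Qed.

Lemma rep_sub c c' f g : rep om c f -> rep om c' g ->
  rep om (fun k => Cminus (c k) (c' k)) (fn_sub f g).
Proof.
move=> Hf Hg; apply: rep_ext (rep_lin (RtoC 1) (Copp (RtoC 1)) Hf Hg) => [k|x].
  by ring.
by rewrite /fn_lin /fn_sub; ring.
Qed.

Lemma sums_wterm_sub c c' B B' : sums_le (wterm om c) B -> sums_le (wterm om c') B' ->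
  sums_le (wterm om (fun k => Cminus (c k) (c' k))) (2 * B + 2 * B').
Proof.
move=> HB HB' l nl.
apply: (Rle_trans _ (fsum l (fun k => 2 * wterm om c k + 2 * wterm om c' k))).
  apply: fsum_le => k _; have := wterm_add c (fun k => Copp (c' k)) k.
  by rewrite /wterm Cmod_opp.
by rewrite fsum_plus !fsum_scal; have := HB l nl; have := HB' l nl; lra.
Qed.

Definition restrict (F : list (freq d)) c : freq d -> C :=
  fun k => if excluded_middle_informative (In k F) then c k else RtoC 0.

Definition trig (F : list (freq d)) c : fn d := fun x => csum F (fun k => Cmult (c k) (wave k x)).

Lemma restrict_in F c k : In k F -> restrict F c k = c k.
Proof. by rewrite /restrict; case: excluded_middle_informative. Qed.

Lemma restrict_out F c k : ~ In k F -> restrict F c k = RtoC 0.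
Proof. by rewrite /restrict; case: excluded_middle_informative. Qed.

Lemma sums_wterm_restrict F c : NoDup F -> sums_le (wterm om (restrict F c)) (fsum F (wterm om c)).
Proof.
move=> nF l nl; have [n [nn [ln Fn]]] := NoDup_union l F.
apply: (Rle_trans _ _ _ (fsum_incl nl ln (fun k _ => wterm_ge0 (restrict F c) k))).
have [r [P _ dis]] := perm_disjoint_complement nF nn Fn.
rewrite (fsum_perm _ P) fsum_app.
rewrite (fsum_ext (l := r) (b := fun _ => 0)); last first.
  by move=> k Hk; rewrite /wterm restrict_out ?Cmod_0; [ring|apply: dis].
rewrite fsum0 (fsum_ext (l := F) (b := wterm om c)); first by lra.
by move=> k Hk; rewrite /wterm restrict_in.
Qed.

Lemma rep_trig F c : NoDup F -> rep om (restrict F c) (trig F c).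
Proof.
move=> nF; split.
  by exists (fsum F (wterm om c)); apply: sums_wterm_restrict.
move=> x; rewrite /trig -(csum_ext (u := fun k => Cmult (restrict F c k) (wave k x))).
  by apply: HasSum_finite => // k Hk; rewrite restrict_out //; ring.
by move=> k Hk; rewrite restrict_in.
Qed.

Lemma ball_trig F c : NoDup F -> fsum F (wterm om c) <= 1 -> Defs.ball om (trig F c).
Proof.
move=> nF H; exists (restrict F c); split; first exact: rep_trig.
by move=> l nl; have := sums_wterm_restrict c nF nl; lra.
Qed.

Lemma functional_trig (L : functional d) F c :
  (forall a b f g, inH om f -> inH om g ->
      L (fn_lin a b f g) = Cplus (Cmult a (L f)) (Cmult b (L g))) ->
  L (trig F c) = csum F (fun k => Cmult (c k) (L (wave k))).
Proof.
move=> HL.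
have hw (k : freq d) : inH om (wave k).
  exists (restrict (k :: nil) (fun _ => RtoC 1)).
  apply: rep_ext (rep_trig _ (NoDup_cons k (@in_nil _ k) (NoDup_nil _))) => [//|x].
  by rewrite /trig /=; ring.
suff G l : inH om (trig l c) /\ L (trig l c) = csum l (fun k => Cmult (c k) (L (wave k))).
  by have [] := G F.
elim: l => [|k l [[c' IH1] IH2]] /=.
  (* [L] of the empty sum vanishes by linearity with both coefficients zero. *)
  have h0 : inH om (trig nil c) by exists (restrict nil c); apply: rep_trig; constructor.
  split=> //; have := HL (RtoC 0) (RtoC 0) _ _ h0 h0.
  rewrite (_ : fn_lin _ _ _ _ = trig nil c) => [->|]; first by ring.
  by apply: functional_extensionality => x; rewrite /fn_lin /trig /=; ring.
have E : trig (k :: l) c = fn_lin (c k) (RtoC 1) (wave k) (trig l c).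
  by apply: functional_extensionality => x; rewrite /trig /fn_lin /=; ring.
have [w Hw] := hw k; split; last by rewrite E HL -?IH2; [ring|exists w|exists c'].
by rewrite E; eexists; apply: rep_lin; [exact: Hw|exact: IH1].
Qed.

Lemma Lstd_Lall M (L : functional d) : sums_le lam M -> Lstd om L -> Lall om L.
Proof.
move=> HM [x [cx HL]]; split; first by move=> *; rewrite !HL.
move=> f Hf e e0.
have M0 : 0 <= M by apply: (HM nil); constructor.
have M1 : 0 < sqrt (M + 1) by apply: sqrt_lt_R0; lra.
exists (e / sqrt (M + 1)); split; first exact: Rdiv_lt_0_compat.
move=> g Hg [c [Hc [eta [Heta Hs]]]]; rewrite !HL.
have eta0 : 0 <= eta by apply: (Hs nil); constructor.
apply: (Rle_lt_trans _ _ _ (rep_bound x HM Hs Hc)).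
have : eta * (M + 1) < e^2.
  have : (e / sqrt (M + 1))^2 * (M + 1) = e^2.
    rewrite /Rdiv Rpow_mult_distr pow_inv pow2_sqrt; last lra.
    by field; lra.
  nra.
rewrite -{2}(sqrt_pow2 e) => [H|]; last lra.
apply: sqrt_lt_1_alt; nra.
Qed.

End Space.

(** * Averages along a one-parameter grid *)

Lemma dotk_line d (k : freq d) r (b : freq d) : dotk k (fun i => r * IZR (b i)) = r * dotk k (fun i => IZR (b i)).
Proof. by rewrite !dotk_fsum -fsum_scal; apply: fsum_ext => i _; ring. Qed.

Lemma dotk_sub d (k k' : freq d) x :
  dotk (fun i => (k i - k' i)%Z) x = dotk k x - dotk k' x.
Proof.
by rewrite !dotk_fsum -fsum_minus; apply: fsum_ext => i _; rewrite minus_IZR; ring.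
Qed.

Lemma dotk_integer d (k b : freq d) : exists z, dotk k (fun i => IZR (b i)) = IZR z.
Proof.
rewrite dotk_fsum; elim: (index_enum _) => [|i l [z IH]] /=; first by exists 0%Z.
by exists (k i * b i + z)%Z; rewrite IH plus_IZR mult_IZR.
Qed.

Lemma list_Z_bound {I : Type} (l : list I) (a : I -> Z) :
  exists P, (0 < P)%Z /\ forall i, In i l -> (Z.abs (a i) < P)%Z.
Proof.
elim: l => [|i l [P [P0 IH]]]; first by exists 1%Z.
exists (P + Z.abs (a i))%Z; split; first lia.
by move=> j /= [<-|/IH]; lia.
Qed.

Lemma IZR_neq0_ge1 z : IZR z <> 0 -> 1 <= Rabs (IZR z).
Proof.
move=> H; rewrite -abs_IZR; apply: IZR_le.
have : z <> 0%Z by move=> E; apply: H; rewrite E.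
lia.
Qed.

(** Induct on [V]. If [v] is orthogonal to [b], replace [b] by [P b + e_i] with [v i <> 0]: then [v]
    gives [v i], and an earlier [w] gives [P] times a nonzero integer plus [w i], which cannot
    vanish once [P > |w i|]. *)
Lemma exists_nonorthogonal d (V : list (freq d)) : (forall v, In v V -> exists i, v i <> 0%Z) ->
  exists b : freq d, forall v, In v V -> dotk v (fun i => IZR (b i)) <> 0.
Proof.
elim: V => [|v V IH] H; first by exists (fun _ => 0%Z).
have [b Hb] := IH (fun w Hw => H w (or_intror Hw)).
case: (classic (dotk v (fun i => IZR (b i)) = 0)) => Hv; last first.
  by exists b => w /= [<-|/Hb].
have [i vi] := H v (or_introl erefl).
have [P [P0 HP]] := list_Z_bound V (fun w => w i).
have E w : dotk w (fun j => IZR (P * b j + (if j == i then 1 else 0))%Z) =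
    IZR P * dotk w (fun j => IZR (b j)) + IZR (w i).
  rewrite !dotk_fsum -fsum_scal (fsum_ext (b := fun j =>
    IZR P * (IZR (w j) * IZR (b j)) + (if j == i then IZR (w j) else 0))).
    rewrite fsum_plus; congr Rplus; rewrite -fsum_bigop (bigD1 (P := predT) i) //= eqxx.
    by rewrite big1 ?Rplus_0_r // => j /negbTE ->.
  by move=> j _; rewrite plus_IZR mult_IZR; case: (j == i); ring.
exists (fun j => P * b j + (if j == i then 1 else 0))%Z => w Hw; rewrite E.
case: Hw => [<-|Hw].
  by rewrite Hv; move=> h; apply: vi; apply: eq_IZR; lra.
have := Hb w Hw; have [z ->] := dotk_integer w b => /IZR_neq0_ge1 h1 h2.
have := IZR_lt _ _ (HP w Hw); rewrite abs_IZR.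
have : Rabs (IZR P * IZR z) = Rabs (IZR (w i)).
  by rewrite (_ : IZR P * IZR z = - IZR (w i)) ?Rabs_Ropp //; lra.
rewrite Rabs_mult (Rabs_pos_eq (IZR P)); have := IZR_lt _ _ P0; nra.
Qed.

(** Along the line spanned by [b], distinct frequencies of [F] keep distinct integer phases, so a
    one-parameter grid can play the role of a [d]-dimensional one. *)
Lemma exists_separating d (F : list (freq d)) :
  exists b : freq d, forall k k', In k F -> In k' F -> k <> k' ->
    dotk k (fun i => IZR (b i)) <> dotk k' (fun i => IZR (b i)).
Proof.
pose V := List.filter (fun v : freq d => if excluded_middle_informative (exists i, v i <> 0%Z) then true else false)
  (List.map (fun p i => (fst p i - snd p i)%Z) (list_prod F F)).
have [|b Hb] := @exists_nonorthogonal d V.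
  by move=> v /filter_In [_]; case: excluded_middle_informative.
exists b => k k' Hk Hk' ne.
have := Hb (fun i => (k i - k' i)%Z); rewrite dotk_sub => H E; apply: H; last lra.
apply/filter_In; split.
  by apply/in_map_iff; exists (k, k'); split=> //; apply/in_prod_iff.
case: excluded_middle_informative => // h; exfalso; apply: ne; apply: functional_extensionality => i.
by apply: NNPP => h'; apply: h; exists i; lia.
Qed.

Lemma geometric_cexpi n a :
  Cmult (Cminus (cexpi a) (RtoC 1)) (csum (List.seq 0 n) (fun j => cexpi (INR j * a))) =
  Cminus (cexpi (INR n * a)) (RtoC 1).
Proof.
elim: n => [|n IH]; first by rewrite /= Rmult_0_l cexpi0; ring.
rewrite seq_S csum_app S_INR /= Rmult_plus_distr_r Rmult_1_l cexpi_plus.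
by rewrite Cmult_plus_distr_l IH; ring.
Qed.

Lemma csum_roots n (u : Z) : u <> 0%Z -> (Z.abs u < Z.of_nat n)%Z ->
  csum (List.seq 0 n) (fun z => cexpi (2 * PI * (INR z * IZR u / INR n))) = RtoC 0.
Proof.
move=> u0 un; have n0 : 0 < INR n by rewrite INR_IZR_INZ; apply: IZR_lt; lia.
set a := 2 * PI * IZR u / INR n.
rewrite (csum_ext (v := fun z => cexpi (INR z * a))); last first.
  by move=> z _; congr cexpi; rewrite /a; field; lra.
have := geometric_cexpi n a.
rewrite (_ : INR n * a = 2 * PI * IZR u); last by rewrite /a; field; lra.
rewrite cexpi_period; set s := csum _ _ => H.
(* [cos a = 1] would make the sine of the half angle [PI u / n] vanish, but the absolute value of
   this angle lies strictly between [0] and [PI]. *)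
have ne : Cminus (cexpi a) (RtoC 1) <> RtoC 0.
  move=> E; have C1 : cos a = 1 by move: (f_equal fst E); rewrite /cexpi /=; lra.
  set h := PI * IZR u / INR n.
  have sn : sin h = 0.
    have := cos_2a_sin h; rewrite (_ : 2 * h = a); last by rewrite /h /a; field; lra.
    rewrite C1; nra.
  have P0 := PI_RGT_0.
  have sp w : (0 < w)%Z -> (w < Z.of_nat n)%Z -> 0 < sin (PI * IZR w / INR n).
    move=> w0 wn.
     have w0' := IZR_lt _ _ w0; have wn' := IZR_lt _ _ wn; rewrite -INR_IZR_INZ in wn'.
    apply: sin_gt_0; first by apply: Rdiv_lt_0_compat; [exact: Rmult_lt_0_compat|].
    apply: (proj2 (Rlt_div_l _ _ _ n0)); nra.
  have [up|un'] : (0 < u)%Z \/ (0 < - u)%Z by lia.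
    have := sp u up ltac:(lia); rewrite -/h; lra.
  have := sp (- u)%Z un' ltac:(lia); rewrite opp_IZR.
  rewrite (_ : PI * - IZR u / INR n = - h); last by rewrite /h; field; lra.
  by rewrite sin_neg; lra.
have : Cmult (Cinv (Cminus (cexpi a) (RtoC 1))) (Cmult (Cminus (cexpi a) (RtoC 1)) s) = RtoC 0.
  by rewrite H; ring.
by rewrite Cmult_assoc Cinv_l // Cmult_1_l.
Qed.

Lemma fsum_delta {I : Type} (l : list I) (a : I -> R) i : NoDup l -> In i l ->
  fsum l (fun j => if excluded_middle_informative (i = j) then a j else 0) = a i.
Proof.
elim: l => [//|j l IH] /NoDup_cons_iff [nj nl] /= [E|Hi].
  rewrite E; case: (excluded_middle_informative (i = i)) => [?|//].
  rewrite -[RHS]Rplus_0_r; congr Rplus; transitivity (fsum l (fun _ => 0)); last exact: fsum0.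
  apply: fsum_ext.
  by move=> k Hk; case: (excluded_middle_informative (i = k)) => [E'|//]; case: nj; rewrite E E'.
case: (excluded_middle_informative (i = j)) => [E|?]; first by case: nj; rewrite -E.
by rewrite IH //=; ring.
Qed.

Lemma csum_delta {I : Type} (l : list I) (a : I -> C) i : NoDup l -> In i l ->
  csum l (fun j => if excluded_middle_informative (i = j) then a j else RtoC 0) = a i.
Proof.
elim: l => [//|j l IH] /NoDup_cons_iff [nj nl] /= [E|Hi].
  rewrite E; case: (excluded_middle_informative (i = i)) => [?|//].
  rewrite -[RHS]Cplus_0_r; congr Cplus; transitivity (csum l (fun _ => RtoC 0)); last exact: csum0.
  apply: csum_ext.
  by move=> k Hk; case: (excluded_middle_informative (i = k)) => [E'|//]; case: nj; rewrite E E'.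
case: (excluded_middle_informative (i = j)) => [E|?]; first by case: nj; rewrite -E.
by rewrite IH //=; ring.
Qed.

Lemma fsum_prod {I J : Type} (l : list I) (m : list J) (a : I -> J -> R) :
  fsum (list_prod l m) (fun p => a (fst p) (snd p)) = fsum l (fun i => fsum m (a i)).
Proof. by elim: l => [//|i l IH] /=; rewrite fsum_app fsum_map IH. Qed.

Lemma csum_prod_iter {I J : Type} (l : list I) (m : list J) (a : I -> J -> C) :
  csum (list_prod l m) (fun p => a (fst p) (snd p)) = csum l (fun i => csum m (a i)).
Proof. by elim: l => [//|i l IH] /=; rewrite csum_app csum_map IH. Qed.

Lemma Cmod2_csum {I : Type} (l : list I) (u : I -> C) :
  RtoC (Cmod (csum l u) ^ 2) = csum l (fun i => csum l (fun j => Cmult (u i) (Cconj (u j)))).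
Proof.
rewrite Cmod2_conj -csum_conj -(csum_prod l l u (fun i => Cconj (u i))).
exact: (csum_prod_iter l l (fun i j => Cmult (u i) (Cconj (u j)))).
Qed.

(** Two distinct phases differ by a nonzero integer smaller than [n] in absolute value, so the cross
    terms are vanishing sums of roots of unity. *)
Lemma parseval_grid {I : Type} (F : list I) (u : I -> C) (ph : I -> Z) n : NoDup F ->
  (forall i j, In i F -> In j F -> i <> j -> ph i <> ph j /\ (Z.abs (ph i - ph j) < Z.of_nat n)%Z) ->
  fsum (List.seq 0 n) (fun z => Cmod (csum F (fun i =>
     Cmult (u i) (cexpi (2 * PI * (INR z * IZR (ph i) / INR n))))) ^ 2) =
  INR n * fsum F (fun i => Cmod (u i) ^ 2).
Proof.
move=> nF H; apply: RtoC_inj; rewrite -csum_RtoC RtoC_mult -csum_RtoC -csum_scal.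
rewrite (csum_ext (fun z _ => Cmod2_csum _ _)) csum_swap.
apply: csum_ext => i Hi; rewrite csum_swap.
rewrite -(csum_delta (fun _ => Cmult (RtoC (INR n)) (RtoC (Cmod (u i) ^ 2))) nF Hi).
apply: csum_ext => j Hj.
rewrite (csum_ext (v := fun z => Cmult (Cmult (u i) (Cconj (u j)))
    (cexpi (2 * PI * (INR z * IZR (ph i - ph j) / INR n))))); last first.
  move=> z _.
  rewrite (_ : 2 * PI * (INR z * IZR (ph i - ph j) / INR n) =
    2 * PI * (INR z * IZR (ph i) / INR n) + - (2 * PI * (INR z * IZR (ph j) / INR n))); last first.
    by rewrite minus_IZR /Rdiv; ring.
  rewrite cexpi_plus cexpi_opp Cmult_conj; ring.
rewrite csum_scal; case: excluded_middle_informative => [E|ne] /=.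
  rewrite -E Z.sub_diag Cmod2_conj (csum_ext (v := fun _ => RtoC 1)).
    by rewrite csum_RtoC fsum_const length_seq Rmult_1_r Cmult_comm.
  by move=> z _; rewrite -cexpi0; congr cexpi; rewrite /Rdiv; ring.
have [h1 h2] := H i j Hi Hj ne.
by rewrite csum_roots //; [ring|lia].
Qed.

(** * Lower bound for arbitrary linear information *)

Lemma Cconj_0 : Cconj (RtoC 0) = RtoC 0.
Proof. by rewrite /Cconj /RtoC /= Ropp_0. Qed.

Section GramSchmidt.
Context {I : Type} (F : list I).
Implicit Types (u v : I -> C) (A : list (I -> C)).

Definition dot u v : C := csum F (fun k => Cmult (u k) (Cconj (v k))).

Definition sqnorm u : R := fsum F (fun k => Cmod (u k) ^ 2).

Lemma dot_conj u v : dot v u = Cconj (dot u v).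
Proof. by rewrite /dot -csum_conj; apply: csum_ext => k _; rewrite Cmult_conj Cconj_conj Cmult_comm. Qed.

Lemma dot_self u : dot u u = RtoC (sqnorm u).
Proof. by rewrite /sqnorm -csum_RtoC; apply: csum_ext => k _; rewrite Cmod2_conj. Qed.

Lemma sqnorm_ge0 u : 0 <= sqnorm u.
Proof. by apply: fsum_ge0 => k _; apply: pow2_ge_0. Qed.

Fixpoint orthonormal A : Prop :=
  if A is a :: A' then
    [/\ dot a a = RtoC 1, forall b, In b A' -> dot a b = RtoC 0 & orthonormal A']
  else True.

Definition residual A u : I -> C := fun k => Cminus (u k) (csum A (fun a => Cmult (dot u a) (a k))).

Lemma orthonormal_sum A a (g : (I -> C) -> C) : orthonormal A -> In a A ->
  csum A (fun b => Cmult (g b) (dot b a)) = g a.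
Proof.
elim: A => [//|b A IH] /= [bb bA oA] [<-|aA].
  rewrite bb (csum_ext (l := A) (v := fun _ => RtoC 0)) ?csum0; first by ring.
  by move=> c /bA E; rewrite dot_conj E Cconj_0; ring.
by rewrite bA // IH //; ring.
Qed.

Lemma dot_residual A u v :
  dot (residual A u) v = Cminus (dot u v) (csum A (fun a => Cmult (dot u a) (dot a v))).
Proof.
rewrite {1}/dot /residual.
rewrite (csum_ext (v := fun k => Cplus (Cmult (u k) (Cconj (v k)))
   (Cmult (Copp (RtoC 1)) (csum A (fun a => Cmult (Cmult (dot u a) (a k)) (Cconj (v k))))))); last first.
  move=> k _; rewrite (csum_ext (u := fun a => Cmult (Cmult (dot u a) (a k)) (Cconj (v k)))
    (v := fun a => Cmult (Cconj (v k)) (Cmult (dot u a) (a k)))); last by move=> a _; ring.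
  by rewrite csum_scal; ring.
rewrite csum_plus csum_scal csum_swap -/(dot u v).
rewrite (csum_ext (l := A) (v := fun a => Cmult (dot u a) (dot a v))); first by ring.
move=> a _; rewrite /dot -csum_scal; apply: csum_ext => k _; rewrite -/(dot u a); ring.
Qed.

Lemma residual_orth A u a : orthonormal A -> In a A -> dot (residual A u) a = RtoC 0.
Proof. by move=> oA aA; rewrite dot_residual orthonormal_sum //; ring. Qed.

Lemma dot_residual_r A u y : (forall a, In a A -> dot y a = RtoC 0) ->
  dot y (residual A u) = dot y u.
Proof.
move=> H; rewrite dot_conj dot_residual (csum_ext (v := fun _ => RtoC 0)).
  by rewrite csum0 (dot_conj u y); congr Cconj; ring.
by move=> a /H E; rewrite (dot_conj y a) E Cconj_0; ring.
Qed.

Lemma residual_dot A u : orthonormal A ->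
  dot (residual A u) u = RtoC (sqnorm (residual A u)).
Proof.
by move=> oA; rewrite -dot_self [RHS]dot_residual_r // => a; apply: residual_orth.
Qed.

Lemma sqnorm_residual A u : orthonormal A ->
  sqnorm (residual A u) = sqnorm u - fsum A (fun a => Cmod (dot u a) ^ 2).
Proof.
move=> oA; apply: RtoC_inj; rewrite -residual_dot // dot_residual dot_self RtoC_minus -csum_RtoC.
by congr Cminus; apply: csum_ext => a _; rewrite Cmod2_conj (dot_conj u a).
Qed.

(** The span of [bs] enters only through its orthogonal complement. A vector with zero residual is
    dropped, hence the inequality between the lengths. *)
Lemma gram_schmidt (bs : list (I -> C)) : exists A, [/\ (length A <= length bs)%coq_nat, orthonormal A &
  forall y, (forall a, In a A -> dot y a = RtoC 0) -> forall b, In b bs -> dot y b = RtoC 0].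
Proof.
elim: bs => [|b bs [A [lA oA HA]]]; first by exists nil.
set p := residual A b.
have Hb y : (forall a, In a A -> dot y a = RtoC 0) -> dot y b = dot y p.
  by move=> H; rewrite /p dot_residual_r.
have [p0|p0] := sqnorm_ge0 p; last first.
  exists A; split=> //=; first by lia.
  move=> y Hy c [<-|]; last exact: HA.
  rewrite Hb //; rewrite /dot (csum_ext (v := fun _ => RtoC 0)) ?csum0 // => k Hk.
  have : Cmod (p k) ^ 2 <= 0.
    rewrite p0; apply: (@fsum_term_le _ _ (fun k => Cmod (p k) ^ 2)) => // j _; exact: pow2_ge_0.
  move=> H; have : Cmod (p k) = 0 by have := Cmod_ge_0 (p k); nra.
  by move=> /Cmod_eq_0 ->; rewrite Cconj_0; ring.
pose s := / sqrt (sqnorm p); have q0 := sqrt_lt_R0 _ p0.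
have s0 : 0 < s by apply: Rinv_0_lt_compat.
pose a : I -> C := fun k => Cmult (RtoC s) (p k).
have da y : dot a y = Cmult (RtoC s) (dot p y).
  by rewrite /dot -csum_scal; apply: csum_ext => k _; rewrite /a; ring.
exists (a :: A); split=> /=; first by lia.
  split=> // [|c cA]; last by rewrite da residual_orth //; ring.
  rewrite da dot_conj da dot_self Cmult_conj.
  rewrite (_ : Cconj (RtoC s) = RtoC s); last by rewrite /Cconj /RtoC /= Ropp_0.
  rewrite (_ : Cconj (RtoC _) = RtoC (sqnorm p)); last by rewrite /Cconj /RtoC /= Ropp_0.
  rewrite -!RtoC_mult; congr RtoC; rewrite -(sqrt_sqrt (sqnorm p)); last lra.
  by rewrite /s; field; lra.
move=> y Hy c [<-|]; last by apply: HA => a' H; apply: Hy; right.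
rewrite Hb; last by move=> a' H; apply: Hy; right.
have := Hy a (or_introl erefl); rewrite dot_conj da Cmult_conj -dot_conj => E.
have : Cmult (RtoC (/ s)) (Cmult (Cconj (RtoC s)) (dot y p)) = RtoC 0 by rewrite E; ring.
rewrite (_ : Cconj (RtoC s) = RtoC s); last by rewrite /Cconj /RtoC /= Ropp_0.
by rewrite Cmult_assoc -RtoC_mult Rinv_l ?Cmult_1_l //; lra.
Qed.

(** The sum is the squared length of the projection of the [k]-th coordinate vector, and the
    residual of that vector has nonnegative squared norm. *)
Lemma bessel_coordinate A k : NoDup F -> In k F -> orthonormal A ->
  fsum A (fun a => Cmod (a k) ^ 2) <= 1.
Proof.
move=> nF kF oA.
pose e : I -> C := fun j => if excluded_middle_informative (k = j) then RtoC 1 else RtoC 0.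
have dk v : dot e v = Cconj (v k).
  rewrite /dot -(csum_delta (fun j => Cconj (v j)) nF kF); apply: csum_ext => j _.
  by rewrite /e; case: excluded_middle_informative => ? /=; ring.
have := sqnorm_ge0 (residual A e); rewrite sqnorm_residual //.
rewrite (fsum_ext (l := A) (b := fun a => Cmod (a k) ^ 2)); last first.
  by move=> a _; rewrite dk Cmod_conj.
rewrite (_ : sqnorm e = 1); first by lra.
rewrite /sqnorm -(fsum_delta (fun _ => 1) nF kF); apply: fsum_ext => j _.
by rewrite /e; case: excluded_middle_informative => ? /=; rewrite ?Cmod_1 ?Cmod_0; ring.
Qed.

End GramSchmidt.

Definition fracpt d (x : pt d) : pt d := fun i => frac_part (x i).

Lemma fracpt_cube d (x : pt d) : cube (fracpt x).
Proof. by move=> i; rewrite /fracpt; have := base_fp (x i); lra. Qed.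

Lemma wave_fracpt d (k : freq d) x : wave k (fracpt x) = wave k x.
Proof.
have [z Hz] := dotk_integer k (fun i => Int_part (x i)).
have E : dotk k x = dotk k (fracpt x) + IZR z.
  rewrite -Hz !dotk_fsum -fsum_plus; apply: fsum_ext => i _.
  by rewrite /fracpt /frac_part; ring.
by rewrite /wave E Rmult_plus_distr_l cexpi_plus cexpi_period Cmult_1_r.
Qed.

Section LowerBound.
Context (om : weights).
Arguments om : clear implicits.
Context (d : nat) (om0 : forall k, 0 < om d k) (M : R) (HM : sums_le (lam om (d := d)) M).

(* [q k] is the squared length of the projection of the [k]-th coordinate vector
   onto the span of the functionals. *)
Lemma lower_bound_fixed n (L : 'I_n -> functional d) (p : fn d) r (F : list (freq d)) :
  NoDup F -> (forall i, Lall om (L i)) ->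
  (forall f, Defs.ball om f -> (forall i, L i f = RtoC 0) -> Rbar_le (ess_sup (fn_sub f p)) (Finite r)) ->
  exists q : freq d -> R, [/\ forall k, In k F -> 0 <= q k <= 1, fsum F q <= INR n &
    fsum F (fun k => lam om k * (1 - q k)) <= r ^ 2].
Proof.
move=> nF LL Hr.
(* In the coordinates [c k * om k], where the norm is Euclidean, the functional [L i] is the inner
   product with this vector, and evaluation at [x] is the one with [g x] below. *)
pose bs := List.map (fun (i : 'I_n) k => Cconj (Cmult (L i (wave k)) (RtoC (/ om d k)))) (enum 'I_n).
have [A [lA oA HA]] := gram_schmidt F bs.
pose g x : freq d -> C := fun k => Cmult (Cconj (wave k x)) (RtoC (/ om d k)).
have conjR a : Cconj (RtoC a) = RtoC a by rewrite /Cconj /RtoC /= Ropp_0.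
have lam2 k : (/ om d k)^2 = lam om k by rewrite /lam pow_inv.
(* the reproducing kernel of the common kernel of the functionals at [x] *)
have Hx x : cube x -> sqnorm F (residual F A (g x)) <= r ^ 2.
  move=> cx; set y := residual F A (g x); set N := sqnorm F y.
  have N0 : 0 <= N by apply: sqnorm_ge0.
  have [Np|<-] := N0; last by apply: pow2_ge_0.
  (* [y] is orthogonal to all of [bs], so these coefficients give a function in the unit ball on
     which every [L i] vanishes; its value at [x] is [sqrt N]. *)
  pose c k := Cmult (RtoC (/ sqrt N)) (Cmult (y k) (RtoC (/ om d k))).
  have q0 := sqrt_lt_R0 _ Np.
  (* The unimodular factor serves for [1] and [-1], since both the fooling function and its negative
     are needed. *)
  have wc a : Cmod a = 1 -> fsum F (wterm om (fun k => Cmult a (c k))) <= 1.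
    move=> Ha; rewrite (fsum_ext (b := fun k => / N * Cmod (y k) ^ 2)).
      by rewrite fsum_scal -/(sqnorm F y) -/N Rinv_l; lra.
    move=> k _; rewrite wterm_scal Ha /wterm /c !Cmod_mult !Cmod_R.
    have o := om0 k; rewrite (Rabs_pos_eq (/ sqrt N)); last by apply: Rlt_le; apply: Rinv_0_lt_compat.
    rewrite (Rabs_pos_eq (/ om d k)); last by apply: Rlt_le; apply: Rinv_0_lt_compat.
    rewrite !Rpow_mult_distr pow_inv pow2_sqrt; last lra.
    by field; split; lra.
  have L0 a i : L i (trig F (fun k => Cmult a (c k))) = RtoC 0.
    rewrite (functional_trig F _ (proj1 (LL i))).
    have ib : In (fun k => Cconj (Cmult (L i (wave k)) (RtoC (/ om d k)))) bs.
      apply/in_map_iff; exists i; split=> //.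
      have := mem_enum 'I_n i; rewrite inE; elim: (enum _) => [//|k s IH].
      by rewrite seq.inE => /orP [/eqP ->|/IH]; [left|right].
    have := HA y (fun a aA => residual_orth _ oA aA) _ ib.
    rewrite /dot => E.
    rewrite -[RHS](_ : Cmult (Cmult a (RtoC (/ sqrt N))) (RtoC 0) = RtoC 0); last by ring.
    rewrite -E -csum_scal; apply: csum_ext => k _.
    by rewrite Cconj_conj /c; ring.
  have f1 := ball_trig nF (wc (RtoC 1) Cmod_1).
  have f2 := ball_trig nF (wc (Copp (RtoC 1)) ltac:(by rewrite Cmod_opp Cmod_1)).
  have H1 := Hr _ f1 (L0 _); have H2 := Hr _ f2 (L0 _).
  set f := trig F (fun k => Cmult (RtoC 1) (c k)) in f1 H1.
  have Ef : trig F (fun k => Cmult (Copp (RtoC 1)) (c k)) = (fun x => Copp (f x)).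
    apply: functional_extensionality => z; rewrite /f /trig.
    rewrite [RHS](_ : _ = Cmult (Copp (RtoC 1)) (csum F (fun k => Cmult (Cmult (RtoC 1) (c k)) (wave k z)))); last by ring.
    by rewrite -csum_scal; apply: csum_ext => k _; ring.
  rewrite Ef in H2.
  have uf : unif_cont f by apply: (rep_unif_cont om0 HM); apply: rep_trig.
  have := ess_sup_symmetric uf cx H1 H2.
  have -> : f x = RtoC (sqrt N).
    have E := residual_dot (g x) oA; rewrite -/y -/N in E.
    rewrite (_ : RtoC (sqrt N) = Cmult (RtoC (/ sqrt N)) (RtoC N)); last first.
      rewrite -RtoC_mult; congr RtoC; rewrite -{3}(sqrt_sqrt N) //; field; lra.
    rewrite -E /f /trig /dot -csum_scal; apply: csum_ext => k _.
    by rewrite /g Cmult_conj Cconj_conj conjR /c; ring.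
  rewrite Cmod_R Rabs_pos_eq; last lra.
  have SS := sqrt_sqrt N N0; move=> H; have := Rmult_le_compat _ _ _ _ (Rlt_le _ _ q0) (Rlt_le _ _ q0) H H.
  by rewrite SS /=; lra.
exists (fun k => fsum A (fun a => Cmod (a k) ^ 2)); split.
- move=> k kF; split; last exact: (bessel_coordinate nF kF oA).

  by apply: fsum_ge0 => a _; apply: pow2_ge_0.
- rewrite fsum_swap (fsum_ext (b := fun _ => 1)); last first.
    move=> a aA; apply: RtoC_inj; rewrite -/(sqnorm F a) -dot_self.
    elim: (A) oA aA => [//|b B IH] /= [h1 _ oB] [<-//|]; exact: IH.
  rewrite fsum_const Rmult_1_r; apply: le_INR.
  by move: lA; rewrite /bs length_map; have -> : length (enum 'I_n) = n by apply: size_enum_ord.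
have [b Hb] := exists_separating F.
have phex k : {z | dotk k (fun i => IZR (b i)) = IZR z}.
  by apply: constructive_indefinite_description; apply: dotk_integer.
pose ph k := sval (phex k); have Eph k : dotk k (fun i => IZR (b i)) = IZR (ph k) := svalP (phex k).
have [P [P0 HP]] := list_Z_bound F ph.
(* All phases are below [P] in absolute value, so their differences are below [2 P]. *)
pose n' := Z.to_nat (2 * P)%Z.
have n0 : 0 < INR n' by rewrite INR_IZR_INZ; apply: IZR_lt; rewrite /n'; lia.
have sep i j : In i F -> In j F -> i <> j -> ph i <> ph j /\ (Z.abs (ph i - ph j) < Z.of_nat n')%Z.
  move=> iF jF ne; split; first by move=> E; apply: (Hb i j iF jF ne); rewrite !Eph E.
  by have := HP i iF; have := HP j jF; rewrite /n'; lia.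
pose xz (z : nat) : pt d := fun i => INR z / INR n' * IZR (b i).
have wz k z : wave k (xz z) = cexpi (2 * PI * (INR z * IZR (ph k) / INR n')).
  by rewrite /wave /xz dotk_line Eph; congr cexpi; field; lra.
(* By Parseval on the grid, the squared inner product with [a] is on average the sum of
   [lam k |a k|^2]. The mean squared norm of the residual thus becomes the sum of
   [lam k (1 - q k)]. *)
have gr a : fsum (List.seq 0 n') (fun z => Cmod (dot F (g (fracpt (xz z))) a) ^ 2) =
    INR n' * fsum F (fun k => lam om k * Cmod (a k) ^ 2).
  rewrite -(fsum_ext (a := fun k => Cmod (Cmult (a k) (RtoC (/ om d k))) ^ 2)); last first.
    by move=> k _; rewrite Cmod_mult Cmod_R Rpow_mult_distr pow2_abs lam2; ring.
  rewrite -(parseval_grid _ nF sep); apply: fsum_ext => z _.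
  rewrite -Cmod_conj /dot -csum_conj; congr (Cmod _ ^ 2); apply: csum_ext => k _.
  by rewrite /g wave_fracpt wz !Cmult_conj !Cconj_conj conjR; ring.
have Hs : fsum (List.seq 0 n') (fun z => sqnorm F (residual F A (g (fracpt (xz z))))) <= INR n' * r ^ 2.
  apply: (Rle_trans _ (fsum (List.seq 0 n') (fun _ => r ^ 2))).
    by apply: fsum_le => z _; apply: Hx; apply: fracpt_cube.
  by rewrite fsum_const length_seq; lra.
have gn x : sqnorm F (g x) = fsum F (lam om (d := d)).
  apply: fsum_ext => k _; rewrite /g Cmod_mult Cmod_R Cmod_conj Cmod_wave Rmult_1_l pow2_abs; exact: lam2.
have Es : fsum (List.seq 0 n') (fun z => sqnorm F (residual F A (g (fracpt (xz z))))) =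
    INR n' * fsum F (fun k => lam om k * (1 - fsum A (fun a => Cmod (a k) ^ 2))).
  rewrite (fsum_ext (b := fun z => fsum F (lam om (d := d)) -
     fsum A (fun a => Cmod (dot F (g (fracpt (xz z))) a) ^ 2))); last first.
    by move=> z _; rewrite sqnorm_residual // gn.
  rewrite fsum_minus fsum_const length_seq fsum_swap (fsum_ext (fun a _ => gr a)) fsum_scal -Rmult_minus_distr_l.
  congr Rmult; rewrite fsum_swap -fsum_minus; apply: fsum_ext => k _.
  by rewrite fsum_scal; ring.
rewrite Es in Hs; exact: Rmult_le_reg_l Hs.
Qed.

End LowerBound.

(** * Sampling along random lines *)

Definition dirichlet (M : nat) (t : R) : C :=
  Cmult (RtoC (/ INR M)) (csum (List.seq 0 M) (fun j => cexpi (INR j * t))).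

Definition fejer (M : nat) (t : R) : R := Cmod (dirichlet M t) ^ 2.

Lemma fejer_ge0 M t : 0 <= fejer M t.
Proof. exact: pow2_ge_0. Qed.

Lemma dirichlet0 M : (0 < M)%nat -> dirichlet M 0 = RtoC 1.
Proof.
move=> M0; have m0 : 0 < INR M by apply: lt_0_INR; apply/ltP.
rewrite /dirichlet (csum_ext (v := fun _ => RtoC 1)); last by move=> j _; rewrite Rmult_0_r cexpi0.
by rewrite csum_RtoC fsum_const length_seq -RtoC_mult; congr RtoC; field; lra.
Qed.

Lemma fejer0 M : (0 < M)%nat -> fejer M 0 = 1.
Proof. by move=> M0; rewrite /fejer dirichlet0 // Cmod_1; ring. Qed.

Lemma fejer_average M n (u : Z) : (0 < M)%nat -> u <> 0%Z ->
  (Z.of_nat M * Z.abs u < Z.of_nat n)%Z ->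
  fsum (List.seq 0 n) (fun z => fejer M (2 * PI * (INR z * IZR u / INR n))) = INR n / INR M.
Proof.
move=> M0 u0 un; have m0 : 0 < INR M by apply: lt_0_INR; apply/ltP.
have n0 : 0 < INR n by rewrite INR_IZR_INZ; apply: IZR_lt; nia.
have H i j : In i (List.seq 0 M) -> In j (List.seq 0 M) -> i <> j ->
    (Z.of_nat i * u)%Z <> (Z.of_nat j * u)%Z /\
    (Z.abs (Z.of_nat i * u - Z.of_nat j * u) < Z.of_nat n)%Z.
  move=> /in_seq hi /in_seq hj ne; split; first by nia.
  by rewrite -Z.mul_sub_distr_r Z.abs_mul; nia.
have := parseval_grid (fun _ => RtoC (/ INR M)) (seq_NoDup M 0) H.
rewrite fsum_const length_seq Cmod_R pow2_abs => E.
rewrite (_ : INR n / INR M = INR n * (INR M * (/ INR M) ^ 2)); last by field; lra.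
rewrite -E; apply: fsum_ext => z _; rewrite /fejer /dirichlet -csum_scal; congr (Cmod _ ^ 2).
apply: csum_ext => j _; congr (Cmult _ (cexpi _)); rewrite mult_IZR -INR_IZR_INZ; field; lra.
Qed.

(** Together with [fejer_vector] this is a feature map of the Fejer kernel: [|E(s - t)|^2] is [M^-2]
    times the sum over pairs [(i, j)] of [cos ((i - j) (s - t))], and the cosine of a difference
    splits into a cosine and a sine part, selected by the boolean. Keeping all pairs avoids the
    triangular weights. *)
Definition fejer_index (M : nat) : list (bool * (nat * nat)) :=
  list_prod (true :: false :: nil) (list_prod (List.seq 0 M) (List.seq 0 M)).

Definition fejer_vector (M : nat) (t : R) (p : bool * (nat * nat)) : R :=
  let w := (INR (fst (snd p)) - INR (snd (snd p))) * t in / INR M * (if fst p then cos w else sin w).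

Lemma fejer_gram M s t :
  fsum (fejer_index M) (fun p => fejer_vector M s p * fejer_vector M t p) = fejer M (s - t).
Proof.
rewrite /fejer_index (fsum_prod _ _ (fun b q => fejer_vector M s (b, q) * fejer_vector M t (b, q))) /=.
rewrite Rplus_0_r -fsum_plus.
have E : fejer M (s - t) = (/ INR M) ^ 2 *
    fst (RtoC (Cmod (csum (List.seq 0 M) (fun j => cexpi (INR j * (s - t)))) ^ 2)).
  by rewrite /fejer /dirichlet Cmod_mult Cmod_R Rpow_mult_distr pow2_abs.
rewrite E Cmod2_csum Re_csum -fsum_scal.
rewrite (fsum_prod _ _ (fun i j => fejer_vector M s (true, (i, j)) * fejer_vector M t (true, (i, j)) +
   fejer_vector M s (false, (i, j)) * fejer_vector M t (false, (i, j)))).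
apply: fsum_ext => i _; rewrite Re_csum -fsum_scal; apply: fsum_ext => j _.
rewrite -cexpi_opp -cexpi_plus /fejer_vector /cexpi /=.
rewrite (_ : INR i * (s - t) + - (INR j * (s - t)) = (INR i - INR j) * s - (INR i - INR j) * t); last ring.
rewrite cos_minus; ring.
Qed.

(** Expand [0 <= |B u - sum_k b_k v_k|^2], where [b_k] is the inner product of [u] and [v_k] and [s]
    is the sum to be bounded. By [2 b b' <= b^2 + b'^2], applied with nonnegative Gram entries as
    weights, and by the row sums, the Gram term is at most [B s]; so [B^2 - 2 B s + B s >= 0]. *)
Lemma bombieri {I J : Type} (G : list I) (m : list J) (u : J -> R) (v : I -> J -> R) B : 0 < B ->
  fsum m (fun p => u p ^ 2) <= 1 ->
  (forall k k', In k G -> In k' G -> 0 <= fsum m (fun p => v k p * v k' p)) ->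
  (forall k, In k G -> fsum G (fun k' => fsum m (fun p => v k p * v k' p)) <= B) ->
  fsum G (fun k => (fsum m (fun p => u p * v k p)) ^ 2) <= B.
Proof.
move=> B0 u1 w0 row.
pose b k := fsum m (fun p => u p * v k p); pose w k k' := fsum m (fun p => v k p * v k' p).
set s := fsum G _.
have wC k k' : w k k' = w k' k by apply: fsum_ext => p _; ring.
have sq : 0 <= fsum m (fun p => (B * u p - fsum G (fun k => b k * v k p)) ^ 2).
  by apply: fsum_ge0 => p _; apply: pow2_ge_0.
have E1 : fsum m (fun p => u p * fsum G (fun k => b k * v k p)) = s.
  rewrite (fsum_ext (l := m) (b := fun p => fsum G (fun k => b k * (u p * v k p)))); last first.
    by move=> p _; rewrite -fsum_scal; apply: fsum_ext => k _; ring.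
  by rewrite fsum_swap; apply: fsum_ext => k _; rewrite fsum_scal -/(b k); ring.
have E2 : fsum m (fun p => (fsum G (fun k => b k * v k p)) ^ 2) = fsum G (fun k => fsum G (fun k' => b k * b k' * w k k')).
  rewrite (fsum_ext (l := m) (b := fun p => fsum G (fun k => fsum G (fun k' => b k * b k' * (v k p * v k' p))))); last first.
    move=> p _; rewrite /= Rmult_1_r -fsum_scal; apply: fsum_ext => k _.
    by rewrite Rmult_comm -fsum_scal; apply: fsum_ext => k' _; ring.
  rewrite fsum_swap; apply: fsum_ext => k _; rewrite fsum_swap; apply: fsum_ext => k' _.
  by rewrite fsum_scal.
have E3 : fsum G (fun k => fsum G (fun k' => b k * b k' * w k k')) <= B * s.
  apply: (Rle_trans _ (fsum G (fun k => fsum G (fun k' => b k ^ 2 / 2 * w k k' + b k' ^ 2 / 2 * w k' k)))).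
    apply: fsum_le => k kG; apply: fsum_le => k' kG'; rewrite (wC k' k).
    have := w0 k k' kG kG'; rewrite -/(w k k'); have := pow2_ge_0 (b k - b k'); nra.
  rewrite (fsum_ext (l := G) (b := fun k => fsum G (fun k' => b k ^ 2 / 2 * w k k') +
     fsum G (fun k' => b k' ^ 2 / 2 * w k' k))); last by move=> k _; rewrite fsum_plus.
  rewrite fsum_plus [X in _ + X]fsum_swap -fsum_plus -fsum_scal; apply: fsum_le => k kG.
  rewrite fsum_scal; have := row k kG; have := pow2_ge_0 (b k); rewrite -/(b k) /w; nra.
move: sq; rewrite (fsum_ext (l := m) (b := fun p => B ^ 2 * u p ^ 2 +
   ((-2 * B) * (u p * fsum G (fun k => b k * v k p)) + (fsum G (fun k => b k * v k p)) ^ 2))); last first.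
  by move=> p _; ring.
rewrite !fsum_plus !fsum_scal E1 E2 => sq.
have : B ^ 2 * fsum m (fun p => u p ^ 2) <= B ^ 2 by have := pow2_ge_0 B; nra.
move=> h; have h1 : 0 <= B * (B - s) by nra.
apply: Rnot_lt_le => h2; nra.
Qed.

(** The Fejer kernel is the inner product of feature vectors of norm one, so Bombieri's inequality
    bounds sums of its square in terms of its own row sums. *)
Lemma fejer_bombieri {I : Type} (G : list I) M (t : I -> R) s B : (0 < M)%nat -> 0 < B ->
  (forall k, In k G -> fsum G (fun k' => fejer M (t k - t k')) <= B) ->
  fsum G (fun k => fejer M (s - t k) ^ 2) <= B.
Proof.
move=> M0 B0 row.
have := @bombieri _ _ G (fejer_index M) (fejer_vector M s) (fun k => fejer_vector M (t k)) B B0.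
rewrite (fsum_ext (l := G) (b := fun k => fejer M (s - t k) ^ 2)); last by move=> k _; rewrite fejer_gram.
apply.
- rewrite (fsum_ext (b := fun p => fejer_vector M s p * fejer_vector M s p)); last by move=> p _; ring.
  by rewrite fejer_gram Rminus_diag fejer0 //; lra.
- by move=> k k' _ _; rewrite fejer_gram; apply: fejer_ge0.
- move=> k kG; rewrite (fsum_ext (b := fun k' => fejer M (t k - t k'))); first exact: row.
  by move=> k' _; rewrite fejer_gram.
Qed.

(** * Choice of directions and recovery of coefficients *)

Definition count {J : Type} (p : J -> bool) (l : list J) : nat := length (List.filter p l).

Lemma INR_count {J : Type} (p : J -> bool) (l : list J) :
  INR (count p l) = fsum l (fun z => if p z then 1 else 0).
Proof. by rewrite -fsum_filter fsum_const Rmult_1_r. Qed.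

Lemma exists_le_average {J : Type} (l : list J) (a : J -> R) c : l <> nil ->
  fsum l a <= INR (length l) * c -> exists z, In z l /\ a z <= c.
Proof.
move=> nl H; apply: NNPP => no.
have : INR (length l) * c < fsum l a.
  rewrite -fsum_const; elim: l nl no {H} => [//|z l IH] _ no /=.
  have hz : c < a z by apply: Rnot_le_lt => h; apply: no; exists z; split=> //; left.
  case: l IH no => [|z' l] IH no; first by move=> /=; lra.
  have : fsum (z' :: l) (fun _ => c) < fsum (z' :: l) a.
    by apply: IH => // -[w [hw1 hw2]]; apply: no; exists w; split=> //; right.
  lra.
lra.
Qed.

(* Method of conditional expectations for the potential [sum_k Q^(number of bad stages of k)]:
   [Z] holds the candidate stages, on average over which the potential at most doubles. *)
Lemma few_bad_stages {I J : Type} (K : list I) (Z : list J) (bad : J -> I -> bool) Q S : 1 <= Q ->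
  Z <> nil -> (forall k, In k K -> Q * INR (count (bad^~ k) Z) <= INR (length Z)) ->
  exists zs, [/\ length zs = S, incl zs Z &
    fsum K (fun k => Q ^ count (bad^~ k) zs) <= INR (length K) * 2 ^ S].
Proof.
move=> Q1 nZ H; elim: S => [|S [zs [lz iz IH]]].
  exists nil; split=> //=.
  by rewrite fsum_const; lra.
pose w k := Q ^ count (bad^~ k) zs; have w0 k : 0 <= w k by apply: pow_le; lra.
have [|z [zZ Hz]] := @exists_le_average _ Z
    (fun z => fsum K (fun k => w k * (if bad z k then Q else 1))) (2 * fsum K w) nZ.
  rewrite fsum_swap; apply: (Rle_trans _ (fsum K (fun k => 2 * INR (length Z) * w k))).
    apply: fsum_le => k kK; rewrite fsum_scal.
    have : fsum Z (fun z => if bad z k then Q else 1) <= 2 * INR (length Z).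
      apply: (Rle_trans _ (fsum Z (fun z => 1 + Q * (if bad z k then 1 else 0)))).
        by apply: fsum_le => z _; case: (bad z k); lra.
      by rewrite fsum_plus fsum_scal -(INR_count (bad^~ k)) fsum_const; have := H k kK; rewrite /=; lra.
    have := w0 k; nra.
  by rewrite fsum_scal; lra.
exists (z :: zs); split=> /=; first by rewrite lz.
  by move=> x [<-|/iz].
rewrite (fsum_ext (b := fun k => w k * (if bad z k then Q else 1))).
  by have IH' : fsum K w <= _ := IH; rewrite /= in IH' *; lra.
by move=> k _; rewrite /w /count /=; case: (bad z k) => /=; ring.
Qed.

Definition decb (P : Prop) : bool := if excluded_middle_informative P then true else false.

Lemma decbP P : reflect P (decb P).
Proof. by rewrite /decb; case: excluded_middle_informative => H; constructor. Qed.

(* The equation at the pair [(z, k)] bounds [a k] by the leakage of the other coefficients;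
   only the stages at which [k] is well separated from [K] are used. *)
Lemma l1_recovery {I J : Type} (K r : list I) (zs : list J) M (t : J -> I -> R) (a : I -> C) e :
  (0 < M)%nat -> zs <> nil ->
  let good z k := fsum K (fun k' => fejer M (t z k - t z k')) <= 5 / 4 in
  (forall k, In k K -> 4 * INR (count (fun z => ~~ decb (good z k)) zs) <= INR (length zs)) ->
  (forall z k, In z zs -> In k K ->
     Cmod (csum (K ++ r) (fun h => Cmult (a h) (Cpow (dirichlet M (t z h - t z k)) 4))) <= e) ->
  fsum K (fun k => Cmod (a k)) <= 4 * (INR (length K) * e) + 5 * fsum r (fun h => Cmod (a h)).
Proof.
move=> M0 nz good few eqn; set A := fsum K _; set T := fsum r _.
pose V z h k := fejer M (t z h - t z k) ^ 2.
pose g z k : R := if decb (good z k) then 1 else 0.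
have S0 : 0 < INR (length zs) by apply: lt_0_INR; case: (zs) nz => [//|? ?] _ /=; lia.
set S := INR (length zs) in few S0 *.
have e0 k : In k K -> 0 <= e.
  case: (zs) nz eqn => [//|z ?] _ eqn kK; have := eqn z k (or_introl erefl) kK.
  have := Cmod_ge_0; move=> H; exact: Rle_trans (H _).
have VE z h k : Cmod (Cpow (dirichlet M (t z h - t z k)) 4) = V z h k.
  by rewrite Cmod_pow /V /fejer; ring.
(* At a good pair the kernel value of [k] itself is [1]; the doubled left side comes from adding the
   isolated term once more to the full sum. *)
have one z k : In z zs -> In k K -> 2 * (g z k * Cmod (a k)) <=
    e + fsum (K ++ r) (fun h => Cmod (a h) * (g z k * V z h k)).
  move=> hz hk; rewrite /g; case: decbP => hg; last first.
    rewrite (fsum_ext (b := fun _ => 0)); last by move=> h _; ring.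
    by rewrite fsum0; have := e0 k hk; lra.
  have := @Cmod_term_le _ (K ++ r) (fun h => Cmult (a h) (Cpow (dirichlet M (t z h - t z k)) 4)) k
    (in_or_app _ _ _ (or_introl hk)).
  rewrite Cmod_mult VE /V Rminus_diag fejer0 //.
  rewrite (fsum_ext (l := K ++ r) (b := fun h => Cmod (a h) * (1 * V z h k))); last first.
    by move=> h _; rewrite Cmod_mult VE; ring.
  have := eqn z k hz hk; rewrite /V; lra.
(* Only the [k] that are good at [z] remain, and goodness bounds their row sums. *)
have col z h : fsum K (fun k => g z k * V z h k) <= 5 / 4.
  rewrite (fsum_ext (b := fun k => if decb (good z k) then V z h k else 0)); last first.
    by move=> k _; rewrite /g; case: decb; ring.
  rewrite -fsum_filter; apply: fejer_bombieri => //; first lra.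
  move=> k /filter_In [kK /decbP gk]; apply: Rle_trans gk.
  rewrite fsum_filter; apply: fsum_le => k' _; case: decb; [lra|exact: fejer_ge0].
have tot : fsum zs (fun z => fsum K (fun k => 2 * (g z k * Cmod (a k)))) <=
    S * (INR (length K) * e + 5 / 4 * (A + T)).
  apply: (Rle_trans _ (fsum zs (fun _ => INR (length K) * e + 5 / 4 * (A + T)))); last first.
    by rewrite fsum_const -/S; lra.
  apply: fsum_le => z hz.
  apply: (Rle_trans _ (fsum K (fun k => e + fsum (K ++ r) (fun h => Cmod (a h) * (g z k * V z h k))))).
    by apply: fsum_le => k hk; apply: one.
  rewrite fsum_plus fsum_const fsum_swap; apply: Rplus_le_compat_l.
  rewrite (_ : A + T = fsum (K ++ r) (fun h => Cmod (a h))); last by rewrite fsum_app.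
  rewrite -fsum_scal; apply: fsum_le => h _; rewrite fsum_scal.
  have := col z h; have := Cmod_ge_0 (a h); nra.
have low : 3 / 2 * S * A <= fsum zs (fun z => fsum K (fun k => 2 * (g z k * Cmod (a k)))).
  rewrite fsum_swap -fsum_scal; apply: fsum_le => k hk.
  rewrite (fsum_ext (b := fun z => 2 * Cmod (a k) * g z k)); last by move=> z _; ring.
  rewrite fsum_scal.
  have : fsum zs (fun z => g z k) = S - INR (count (fun z => ~~ decb (good z k)) zs).
    rewrite INR_count /S -(Rmult_1_r (INR _)) -fsum_const -fsum_minus; apply: fsum_ext => z _.
    by rewrite /g; case: decb => /=; ring.
  move=> ->; have := few k hk; have := Cmod_ge_0 (a k); nra.
(* Three quarters of good stages give [3/2 A] on the left and the columns give [5/4 (A + T)] on the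
   right; the margin [A / 4] survives. *)
have : S * (A / 4) <= S * (INR (length K) * e + 5 / 4 * T) by nra.
move=> /(Rmult_le_reg_l _ _ _ S0); lra.
Qed.

(** Only nonnegative multiples of [t] occur, at most [4 (M - 1)], so the fourth power at an angle
    difference is a combination of waves at the nodes of one line. *)
Lemma dirichlet_pow4 M t : Cpow (dirichlet M t) 4 =
  csum (let s := List.seq 0 M in list_prod (list_prod s s) (list_prod s s))
    (fun p => Cmult (RtoC (/ INR M ^ 4))
       (cexpi (INR (fst (fst p) + snd (fst p) + (fst (snd p) + snd (snd p)))%nat * t))).
Proof.
cbv zeta; set s := List.seq 0 M.
pose e (q : nat * nat) := Cmult (cexpi (INR (fst q) * t)) (cexpi (INR (snd q) * t)).
rewrite (csum_ext (v := fun p => Cmult (RtoC (/ INR M ^ 4)) (Cmult (e (fst p)) (e (snd p))))); last first.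
  by move=> p _; rewrite !plus_INR !Rmult_plus_distr_r !cexpi_plus.
rewrite csum_scal (csum_prod (list_prod s s) (list_prod s s) e e).
rewrite (csum_prod s s (fun j => cexpi (INR j * t)) (fun j => cexpi (INR j * t))) /dirichlet -/s.
by rewrite -pow_inv RtoC_pow /=; ring.
Qed.

(** The number of stages times the number of nodes on each line, [4 M + 1] with
    [M = 1024 (n + 1)]. *)
Definition sample_budget (n : nat) : nat := ((Nat.log2 n).+1 * (4 * (1024 * n.+1)).+1)%nat.

Section Sampling.
Context (om : weights).
Arguments om : clear implicits.
Context (d : nat) (om0 : forall k, 0 < om d k).

Lemma exists_stages (K : list (freq d)) : NoDup K ->
  let M := (1024 * (length K).+1)%nat in
  exists (n : nat) (b : freq d) (zs : list nat),
    let t (z : nat) (h : freq d) := 2 * PI * (INR z * dotk h (fun i => IZR (b i)) / INR n) in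
    [/\ 0 < INR n, length zs = (Nat.log2 (length K)).+1 &
    forall k, In k K -> 4 * INR (count (fun z =>
       ~~ decb (fsum K (fun k' => fejer M (t z k - t z k')) <= 5 / 4)) zs) <= INR (length zs)].
Proof.
move=> nK M; have M0 : (0 < M)%nat by rewrite /M muln_gt0.
have m0 : 0 < INR M by apply: lt_0_INR; apply/ltP.
have [b Hb] := exists_separating K.
have phex k : {z | dotk k (fun i => IZR (b i)) = IZR z}.
  by apply: constructive_indefinite_description; apply: dotk_integer.
pose ph k := sval (phex k); have Eph k : dotk k (fun i => IZR (b i)) = IZR (ph k) := svalP (phex k).
have [P [P0 HP]] := list_Z_bound K ph.
(* Phase differences are below [2 P], so [M |u| < n] holds for them, as [fejer_average] requires. *)
pose n := Z.to_nat (Z.of_nat M * (2 * P))%Z.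
have MZ : (0 < Z.of_nat M)%Z by have /ltP := M0; lia.
have nE : Z.of_nat n = (Z.of_nat M * (2 * P))%Z by rewrite /n Z2Nat.id //; nia.
have n0 : 0 < INR n by rewrite INR_IZR_INZ nE; apply: IZR_lt; nia.
pose t (z : nat) (h : freq d) := 2 * PI * (INR z * dotk h (fun i => IZR (b i)) / INR n).
pose bad z k := ~~ decb (fsum K (fun k' => fejer M (t z k - t z k')) <= 5 / 4).
exists n, b; change (exists zs, [/\ 0 < INR n, length zs = (Nat.log2 (length K)).+1 &
  forall k, In k K -> 4 * INR (count (bad^~ k) zs) <= INR (length zs)]).
(* The off-diagonal mean is at most [|K| / M <= 1 / 1024], and a bad stage exceeds the diagonal term
   [1] by more than [1 / 4]; by Markov's inequality at most one stage in [256] is bad for [k]. *)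
have badn k : In k K -> 256 * INR (count (bad^~ k) (List.seq 0 n)) <= INR (length (List.seq 0 n)).
  move=> kK; rewrite INR_count length_seq.
  have avg k' : In k' K -> k <> k' ->
      fsum (List.seq 0 n) (fun z => fejer M (t z k - t z k')) = INR n / INR M.
    move=> kK' ne; rewrite -(@fejer_average M n (ph k - ph k')) //.
    - apply: fsum_ext => z _; congr fejer; rewrite /t !Eph minus_IZR; field; lra.
    - by move=> E; apply: (Hb k k' kK kK' ne); rewrite !Eph; congr IZR; lia.
    - by have := HP k kK; have := HP k' kK'; rewrite nE; nia.
  have tot : fsum (List.seq 0 n) (fun z => fsum K (fun k' => fejer M (t z k - t z k'))) <=
      INR n + INR (length K) * (INR n / INR M).
    rewrite fsum_swap; have [l1 [l2 E]] := in_split _ _ kK.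
    rewrite E in nK kK avg *.
    rewrite (fsum_perm _ (Permutation_sym (Permutation_middle l1 l2 k))) /=.
    rewrite (fsum_ext (b := fun _ => 1)); last by move=> z _; rewrite Rminus_diag fejer0.
    rewrite fsum_const length_seq Rmult_1_r; apply: Rplus_le_compat_l.
    rewrite (fsum_ext (b := fun _ => INR n / INR M)).
      rewrite fsum_const !length_app /=; apply: Rmult_le_compat_r; first by apply: Rlt_le; apply: Rdiv_lt_0_compat.
      by apply: le_INR; lia.
    move=> k' Hk'; have := NoDup_remove_2 _ _ _ nK => nk; apply: avg.
      by apply: in_or_app; case: (in_app_or _ _ _ Hk'); [left|right; right].
    by move=> E'; apply: nk; rewrite E'.
  have mk : fsum (List.seq 0 n) (fun z => 1 + / 4 * (if bad z k then 1 else 0)) <=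
      fsum (List.seq 0 n) (fun z => fsum K (fun k' => fejer M (t z k - t z k'))).
    apply: fsum_le => z _; rewrite /bad; case: decbP => hg /=; last lra.
    have := @fsum_term_le _ K (fun k' => fejer M (t z k - t z k')) k (fun j _ => fejer_ge0 _ _) kK.
    by rewrite Rminus_diag fejer0 //; lra.
  rewrite fsum_plus fsum_scal fsum_const length_seq in mk.
  have MK : INR M = 1024 * (INR (length K) + 1) by rewrite /M mult_INR (S_INR (length K)) (INR_IZR_INZ 1024).
  have Lk : INR (length K) * (INR n / INR M) <= INR n / 1024.
    have k0 := pos_INR (length K).
    rewrite MK (_ : _ * _ = INR n / 1024 * (INR (length K) / (INR (length K) + 1))); last by field; lra.
    have k1 : INR (length K) + 1 > 0 by lra.
    have : INR (length K) / (INR (length K) + 1) <= 1 by apply: (proj2 (Rle_div_l _ _ _ k1)); lra.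
    nra.
  lra.
have nZ : List.seq 0 n <> nil.
  by case: (n) n0 => [|m] //=; lra.
(* With [S] stages and [|K| <= 2^S] the potential is at most [4^S]; as [256 = 4^4], no [k] is bad in
   more than [S / 4] stages. *)
have [|zs [lz _ Hz]] := @few_bad_stages _ _ K (List.seq 0 n) bad 256 (Nat.log2 (length K)).+1 _ nZ badn; first lra.
exists zs; split=> // k kK; rewrite lz; set S := (Nat.log2 _).+1 in lz Hz *.
have LK : INR (length K) <= 2 ^ S.
  have h0 : (0 < length K)%coq_nat by case: (K) kK => [//|? ?] _ /=; lia.
  have [_ h1] := Nat.log2_spec _ h0.
  have <- : INR (Nat.pow 2 S) = 2 ^ S by rewrite pow_INR.
  by apply: le_INR; rewrite /S; lia.
have : (256 : R) ^ count (bad^~ k) zs <= (4 : R) ^ S.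
  apply: (Rle_trans _ (INR (length K) * 2 ^ S)).
    apply: Rle_trans Hz.
    apply: (@fsum_term_le _ K (fun k => 256 ^ count (bad^~ k) zs)) => // j _; apply: pow_le; lra.
  rewrite (_ : 4 = 2 * 2); last ring.
  rewrite Rpow_mult_distr; apply: Rmult_le_compat_r => //; apply: pow_le; lra.
rewrite (_ : 256 = 4 ^ 4); last ring.
rewrite -pow_mult => H.
have {H} : (4 * count (bad^~ k) zs <= S)%coq_nat.
  apply: (proj1 (Nat.nlt_ge _ _)) => h; have : (4 : R) ^ S < 4 ^ (4 * count (bad^~ k) zs)%coq_nat by apply: Rlt_pow => //; lra.
  lra.
by move=> /le_INR; rewrite mult_INR (_ : INR 4 = 4) //; rewrite /=; ring.
Qed.

Lemma sampling_points (K : list (freq d)) T : NoDup K ->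
  (forall r, NoDup r -> disjoint_lists r K -> fsum r (lam om (d := d)) <= T) ->
  exists pts : list (pt d), [/\ forall x, In x pts -> cube x, length pts = sample_budget (length K) &
    forall f g, Defs.ball om f -> Defs.ball om g -> (forall x, In x pts -> f x = g x) ->
      forall x, Cmod (Cminus (f x) (g x)) <= 12 * sqrt T].
Proof.
move=> nK HT; have [n [b [zs]]] := exists_stages nK.
set M := (1024 * (length K).+1)%nat.
pose t (z : nat) (h : freq d) := 2 * PI * (INR z * dotk h (fun i => IZR (b i)) / INR n).
move=> [n0 lz few].
have M0 : (0 < M)%nat by rewrite /M muln_gt0.
(* Multiples [i] of the direction [z b / n], where the wave of frequency [h] has angle [i] times
   [t z h]. Letting [i] run up to [4 M] includes all exponents of [E^4]. *)
pose node (p : nat * nat) : pt d := fracpt (fun i => INR (fst p) * INR (snd p) / INR n * IZR (b i)).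
have wn h z i : wave h (node (z, i)) = cexpi (INR i * t z h).
  by rewrite wave_fracpt /wave dotk_line /t; congr cexpi; rewrite /=; field; lra.
exists (List.map node (list_prod zs (List.seq 0 (4 * M).+1))); split.
- by move=> x /in_map_iff [p [<- _]]; apply: fracpt_cube.
- by rewrite length_map length_prod length_seq lz.
move=> f g [c [Hc Bc]] [c' [Hc' Bc']] fg x.
pose a k := Cminus (c k) (c' k).
have [_ Ha] := rep_sub Hc Hc'.
(* [4 = 2 * 1 + 2 * 1], as both functions lie in the unit ball. *)
have wa : sums_le (wterm om a) 4.
  move=> l nl; have := sums_wterm_sub Bc Bc' nl; rewrite -/a; lra.
(* Expanding the fourth power turns the sum into a combination of values of [f - g] at nodes. *)
have zero z k : In z zs -> HasSum (fun h => Cmult (a h) (Cpow (dirichlet M (t z h - t z k)) 4)) (RtoC 0).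
  move=> hz.
  pose s := List.seq 0 M; pose J := list_prod (list_prod s s) (list_prod s s).
  pose deg (p : (nat * nat) * (nat * nat)) := (fst (fst p) + snd (fst p) + (fst (snd p) + snd (snd p)))%nat.
  rewrite (_ : (fun h => _) = (fun h => csum J (fun p => Cmult (Cmult (RtoC (/ INR M ^ 4)) (cexpi (- (INR (deg p) * t z k))))
      (Cmult (a h) (wave h (node (z, deg p))))))); last first.
    apply: functional_extensionality => h; rewrite dirichlet_pow4 -csum_scal; apply: csum_ext => p _.
    rewrite wn -/(deg p) (_ : INR (deg p) * (t z h - t z k) = - (INR (deg p) * t z k) + INR (deg p) * t z h); last ring.
    by rewrite cexpi_plus; ring.
  rewrite -(csum0 J); apply: (HasSum_csum (v := fun _ => RtoC 0)) => -[[j1 j2] [j3 j4]].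
  move=> /in_prod_iff [/in_prod_iff [/in_seq h1 /in_seq h2] /in_prod_iff [/in_seq h3 /in_seq h4]].
  set p := (_, _); set w := Cmult _ (cexpi _).
  rewrite -[X in HasSum _ X](_ : Cmult w (RtoC 0) = RtoC 0); last by ring.
  apply: HasSum_scal; have := Ha (node (z, deg p)).
  rewrite /fn_sub fg; first by rewrite (_ : Cminus _ _ = RtoC 0) //; ring.
  apply/in_map_iff; exists (z, deg p); split=> //; apply/in_prod_iff; split=> //.
  apply/in_seq; rewrite /deg /p /=; move: h1 h2 h3 h4; move: (M) => m.
  by rewrite -!plusE -!multE; lia.
have T0 : 0 <= T by apply: (HT nil); [constructor|move=> ? []].
set nK' := INR (length K).
have k0 : 0 <= nK' by apply: pos_INR.
have main e : 0 < e -> Cmod (Cminus (f x) (g x)) <= 12 * sqrt T + (1 + 4 * nK') * e.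
  move=> e0.
  (* [None] stands for the value at [x] and [Some (z, k)] for the equation at that pair; all of them
     are truncated to one list. *)
  pose Q := (None : option (nat * freq d)) :: List.map Some (list_prod zs K).
  pose A (q : option (nat * freq d)) h := if q is Some p
     then Cmult (a h) (Cpow (dirichlet M (t (fst p) h - t (fst p) (snd p))) 4)
     else Cmult (a h) (cexpi (2 * PI * dotk h x)).
  pose v (q : option (nat * freq d)) := if q is Some p then RtoC 0 else Cminus (f x) (g x).
  have [||l [nl Kl Hl]] := @HasSum_approx d _ Q A v K e.
  - move=> q /= [<-|/in_map_iff [[z k] [<- /in_prod_iff [hz hk]]]]; first exact: Ha.
    exact: zero.
  - exact: e0.
  have [r [P nr dr]] := perm_disjoint_complement nK nl Kl.
  have eqn z k : In z zs -> In k K ->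
     Cmod (csum (K ++ r) (fun h => Cmult (a h) (Cpow (dirichlet M (t z h - t z k)) 4))) <= e.
    move=> hz hk; have := Hl (Some (z, k)); rewrite (csum_perm _ P) /v /A.
    rewrite (_ : Cminus _ (RtoC 0) = csum (K ++ r) (fun h => Cmult (a h) (Cpow (dirichlet M (t z h - t z k)) 4))); last by rewrite /=; ring.
    move=> H; apply: Rlt_le; apply: H; right; apply/in_map_iff; exists (z, k); split=> //.
    by apply/in_prod_iff.
  have nz : zs <> nil by move=> E; move: lz; rewrite E.
  have R1 := l1_recovery M0 nz few eqn.
  (* Cauchy-Schwarz with squared norm [4] gives [2 sqrt T] off [K]. The recovery bound adds five
     times as much on [K], whence [6 * 2 = 12]. *)
  have R2 : fsum r (fun h => Cmod (a h)) <= 2 * sqrt T.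
    have := sum_coef_le om0 (wa r nr) (HT r nr dr).
    rewrite sqrt_mult; [|lra|lra]; rewrite (_ : sqrt 4 = 2); first done.
    by rewrite (_ : 4 = 2 * 2); [rewrite sqrt_square; lra|ring].
  have R3 := Hl None (or_introl erefl); rewrite /v /A in R3.
  have R4 := Cmod_csum l (fun h => Cmult (a h) (cexpi (2 * PI * dotk h x))).
  rewrite (fsum_perm _ P) fsum_app in R4.
  rewrite !(fsum_ext (b := fun h => Cmod (a h))) in R4; try by move=> h _; rewrite Cmod_mult Cmod_cexpi Rmult_1_r.
  set X := csum l _ in R3 R4.
  have := Cmod_triangle X (Copp (Cminus X (Cminus (f x) (g x)))).
  rewrite Cmod_opp (_ : Cplus X _ = Cminus (f x) (g x)); last by ring.
  rewrite -/nK' in R1; lra.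
apply: le_epsilon => e e0.
have q0 : 0 < 1 + 4 * nK' by lra.
have := main (e / (1 + 4 * nK')) (Rdiv_lt_0_compat _ _ e0 q0).
by rewrite (_ : _ * (e / _) = e) //; field; lra.
Qed.

End Sampling.

(** * Comparison of the minimal errors *)

Lemma list_min_pos {I : Type} (l : list I) (a : I -> R) : (forall i, 0 < a i) ->
  exists m, 0 < m /\ forall i, In i l -> m <= a i.
Proof.
move=> a0; elim: l => [|i l [m [m0 IH]]]; first by exists 1; split=> //; lra.
exists (Rmin (a i) m); split; first by apply: Rmin_glb_lt.
move=> j /= [<-|/IH H]; first exact: Rmin_l.
exact: Rle_trans (Rmin_r _ _) H.
Qed.

Lemma exists_exhausting_list {I : Type} (P : I -> Prop) B :
  (forall l, NoDup l -> (forall i, In i l -> P i) -> (length l <= B)%nat) ->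
  exists l, NoDup l /\ forall i, In i l <-> P i.
Proof.
move=> H; apply: NNPP => no.
have G m : exists l, [/\ NoDup l, forall i, In i l -> P i & length l = m].
  elim: m => [|m [l [nl Pl lm]]]; first by exists nil; split=> //; constructor.
  have [i [Pi il]] : exists i, P i /\ ~ In i l.
    apply: NNPP => no'; apply: no; exists l; split=> // i; split; first exact: Pl.
    by move=> Pi; apply: NNPP => il; apply: no'; exists i.
  exists (i :: l); split=> /=; [by constructor| |by rewrite lm].
  by move=> j [<-|/Pl].
have [l [nl Pl lm]] := G B.+1.
by have := H l nl Pl; rewrite lm ltnn.
Qed.

Lemma Rbar_glb_correct E : Rbar_is_glb E (Rbar_glb E).
Proof. exact: (proj2_sig (Rbar_ex_glb E)). Qed.

Lemma Rbar_lub_correct E : Rbar_is_lub E (Rbar_lub E).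
Proof. exact: (proj2_sig (Rbar_ex_lub E)). Qed.

Lemma Rbar_mult_pos_p_infty r : 0 < r -> Rbar_mult (Finite r) p_infty = p_infty.
Proof. by move=> r0; rewrite Rbar_mult_comm; apply: is_Rbar_mult_unique; apply: is_Rbar_mult_p_infty_pos. Qed.

Lemma Rbar_mult_pos_m_infty r : 0 < r -> Rbar_mult (Finite r) m_infty = m_infty.
Proof. by move=> r0; rewrite Rbar_mult_comm; apply: is_Rbar_mult_unique; apply: is_Rbar_mult_m_infty_pos. Qed.

Section Errors.
Context (om : weights).
Arguments om : clear implicits.
Context (d : nat) (d1 : (1 <= d)%nat) (om0 : forall k, 0 < om d k).
Context (M : R) (HM : sums_le (lam om (d := d)) M).

(** The infimum over algorithms need not be attained, hence the passage from [r] to a larger [r'].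
    Only the output at zero information matters. *)
Lemma err_Lall_lower n r r' (F : list (freq d)) : Rbar_le (err Lall om d n) (Finite r) -> r < r' ->
  NoDup F -> exists q : freq d -> R, [/\ forall k, In k F -> 0 <= q k <= 1, fsum F q <= INR n &
    fsum F (fun k => lam om k * (1 - q k)) <= r' ^ 2].
Proof.
move=> Hr rr' nF.
rewrite /err in Hr; move: Hr; set E := (fun v : Rbar => _) => Hr.
have [_ glb] := Rbar_glb_correct E.
have [v [[L [phi [LL [_ Ev]]]] Hv]] : exists v, E v /\ Rbar_lt v r'.
  apply: NNPP => no; have : Rbar_le r' r; last by move=> /=; lra.
  apply: Rbar_le_trans Hr; apply: glb => v Ev; apply: Rbar_not_lt_le => h; apply: no; by exists v.
apply: (lower_bound_fixed om0 HM (p := phi (fun _ => RtoC 0)) nF LL) => f bf Lf.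
have [ub _] := Rbar_lub_correct (fun v => exists f, Defs.ball om f /\
              v = ess_sup (fn_sub f (phi (fun i => L i f)))).
apply: Rbar_le_trans (Rbar_lt_le _ _ Hv); rewrite Ev; apply: ub; exists f; split=> //.
by congr (ess_sup (fn_sub f (phi _))); apply: functional_extensionality => i; rewrite Lf.
Qed.

(** On [n + 1] frequencies the [q k] sum to at most [n], so the sum of [lam k (1 - q k)] is at least
    the smallest [lam k] among them. Positivity provides the gap between [r] and [2 r] that absorbs
    the unattained infimum. *)
Lemma err_Lall_pos n r : Rbar_le (err Lall om d n) (Finite r) -> 0 < r.
Proof.
move=> Hr; apply: Rnot_le_lt => r0.
pose F : list (freq d) := List.map (fun j _ => Z.of_nat j) (List.seq 0 n.+1).
have nF : NoDup F.
  apply: FinFun.Injective_map_NoDup; last exact: seq_NoDup.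
  by move=> i j /(f_equal (fun k => k (Ordinal d1))) /Nat2Z.inj.
have lF : length F = n.+1 by rewrite length_map length_seq.
have [m [m0 Hm]] := list_min_pos F (lam_gt0 om0).
have s0 := sqrt_lt_R0 _ m0.
have [|||q [q01 sq Hq]] := @err_Lall_lower n r (sqrt m / 2) F => //; first lra.
have : m * (INR n.+1 - INR n) <= (sqrt m / 2) ^ 2.
  apply: Rle_trans Hq; apply: (Rle_trans _ (fsum F (fun k => m * (1 - q k)))).
    rewrite fsum_scal fsum_minus fsum_const lF; apply: Rmult_le_compat_l; lra.
  by apply: fsum_le => k kF; have := Hm k kF; have := q01 k kF; nra.
rewrite S_INR; have := sqrt_sqrt m (Rlt_le _ _ m0); nra.
Qed.

(** [K] collects the frequencies with [lam k >= t]. For a list [l] of such frequencies,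
    [t (|l| - n) <= (2 r)^2 = t (n + 1)], so [|l| <= 2 n + 1]. Off [K], the parts weighted by
    [1 - q] and by [q] contribute at most [4 r^2] each, the latter because [lam < t] there and [q]
    sums to at most [n]. *)
Lemma err_Lall_spectrum n r : Rbar_le (err Lall om d n) (Finite r) ->
  exists K : list (freq d), [/\ NoDup K, (length K <= n.*2.+1)%nat &
    forall l, NoDup l -> disjoint_lists l K -> fsum l (lam om (d := d)) <= 8 * r ^ 2].
Proof.
move=> Hr; have r0 := err_Lall_pos Hr; have n0 := pos_INR n.
set t := (2 * r) ^ 2 / (INR n + 1).
have t1 : t * (INR n + 1) = (2 * r) ^ 2 by rewrite /t; field; lra.
have t0 : 0 < t by apply: Rdiv_lt_0_compat; [apply: pow_lt; lra|lra].
have small (l : list (freq d)) : NoDup l -> (forall k, In k l -> t <= lam om k) -> (length l <= n.*2.+1)%nat.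
  move=> nl Hl; have [|||q [q01 sq Hq]] := @err_Lall_lower n r (2 * r) l => //; first lra.
  have : t * (INR (length l) - INR n) <= t * (INR n + 1).
    rewrite t1; apply: Rle_trans Hq; apply: (Rle_trans _ (fsum l (fun k => t * (1 - q k)))).
      rewrite fsum_scal fsum_minus fsum_const; apply: Rmult_le_compat_l; lra.
    by apply: fsum_le => k kF; have := Hl k kF; have := q01 k kF; nra.
  move=> /(Rmult_le_reg_l _ _ _ t0) H; apply/leP/INR_le.
  by rewrite -addnn -addn1 !plus_INR /=; lra.
have [K [nK HK]] := exists_exhausting_list small.
exists K; split=> //; first by apply: small => // k /HK.
move=> l nl dis; have [|||q [q01 sq Hq]] := @err_Lall_lower n r (2 * r) l => //; first lra.
have : fsum l (fun k => lam om k * q k) <= t * INR n.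
  apply: (Rle_trans _ (fsum l (fun k => t * q k))).
    apply: fsum_le => k kl; have : lam om k < t.
      by apply: Rnot_le_lt => /HK; apply: dis.
    have := q01 k kl; nra.
  by rewrite fsum_scal; nra.
rewrite (fsum_ext (l := l) (a := lam om (d := d)) (b := fun k => lam om k * (1 - q k) + lam om k * q k)).
  rewrite fsum_plus; nra.
by move=> k _; ring.
Qed.

(** [phi] returns any function of the ball with the given data, which therefore agrees with [f] at
    the nodes. For inconsistent data it returns zero, since every output has to lie in [Linf]. *)
Lemma err_Lstd_upper (pts : list (pt d)) B : (forall x, In x pts -> cube x) ->
  (forall f g, Defs.ball om f -> Defs.ball om g -> (forall x, In x pts -> f x = g x) ->
      forall x, Cmod (Cminus (f x) (g x)) <= B) ->
  Rbar_le (err Lstd om d (length pts)) (Finite B).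
Proof.
move=> cp Hp.
pose L (i : 'I_(length pts)) : functional d := fun f => f (List.nth i pts (fun _ => 0)).
have Lin (i : 'I_(length pts)) : In (List.nth i pts (fun _ => 0)) pts by apply: nth_In; apply/ltP; apply: (ltn_ord i).
pose Q y f := Defs.ball om f /\ forall i, L i f = y i.
pose phi y : fn d := match excluded_middle_informative (exists f, Q y f) with
  | left e => sval (constructive_indefinite_description _ e)
  | right _ => trig nil (fun _ => RtoC 0) end.
have phiP y f : Q y f -> Q y (phi y).
  move=> Qf; rewrite /phi; case: excluded_middle_informative => [e|no]; last by case: no; exists f.
  exact: (svalP (constructive_indefinite_description _ e)).
have phiL y : Linf (phi y).
  rewrite /phi; case: excluded_middle_informative => [e|no].
    have [[c [Hc _]] _] := svalP (constructive_indefinite_description _ e).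
    exact: (rep_Linf om0 d1 HM Hc).
  exact: (rep_Linf om0 d1 HM (rep_trig om (fun _ => RtoC 0) (NoDup_nil _))).
have [lb _] := Rbar_glb_correct (fun v => exists (L : 'I_(length pts) -> functional d) (phi : ('I_(length pts) -> C) -> fn d),
     (forall i, Lstd om (L i)) /\ (forall y, Linf (phi y)) /\ v = wc_err om L phi).
apply: (Rbar_le_trans _ (wc_err om L phi)).
  apply: lb; exists L, phi; split=> //.
  by move=> i; exists (List.nth i pts (fun _ => 0)); split=> //; apply: cp.
have [_ lub] := Rbar_lub_correct (fun v => exists f, Defs.ball om f /\
              v = ess_sup (fn_sub f (phi (fun i => L i f)))).
apply: lub => v [f [bf ->]]; apply: ess_sup_le => // x _.
have [bg Hg] := phiP (fun i => L i f) f (conj bf (fun i => erefl)).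
apply: Hp => // z /(In_nth _ _ (fun _ => 0)) [i [/ltP il <-]].
by have := Hg (Ordinal il); rewrite /L /= => ->.
Qed.

Lemma err_Lstd_le n r : Rbar_le (err Lall om d n) (Finite r) ->
  exists2 m, (m <= sample_budget (n.*2.+1))%nat & Rbar_le (err Lstd om d m) (Finite (36 * r)).
Proof.
move=> Hr; have r0 := err_Lall_pos Hr.
have [K [nK lK HK]] := err_Lall_spectrum Hr.
have [pts [cp lp Hp]] := sampling_points om0 nK HK.
exists (length pts).
  rewrite lp /sample_budget; apply: leq_mul; last by rewrite ltnS !leq_mul2l ltnS lK orbT.
  by rewrite ltnS; apply/leP; apply: Nat.log2_le_mono; apply/leP.
apply: Rbar_le_trans (err_Lstd_upper cp Hp) _.
(* [sqrt 8] is rounded up to [3], and [12 * 3 = 36]. *)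
have H3 : sqrt (8 * r ^ 2) <= 3 * r.
  rewrite -(sqrt_pow2 (3 * r)); last lra.
  apply: sqrt_le_1_alt; nra.
by change (12 * sqrt (8 * r ^ 2) <= 36 * r); lra.
Qed.

Lemma err_Lall_le_Lstd n : Rbar_le (err Lall om d n) (err Lstd om d n).
Proof.
apply: Rbar_glb_subset => v [L [phi [LL H]]]; exists L, phi; split=> // i.
exact: (Lstd_Lall om0 HM (LL i)).
Qed.

End Errors.

Lemma is_nstar_exists Lam s om eps d m : Rbar_le (err Lam om d m) (Rbar_mult (Finite eps) (CRI s om d)) ->
  exists2 n, is_nstar Lam s om eps d n & (n <= m)%nat.
Proof.
move=> H; pose P k := decb (Rbar_le (err Lam om d k) (Rbar_mult (Finite eps) (CRI s om d))).
have ex : exists k, P k by exists m; apply/decbP.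
case: (ex_minnP ex) => n /decbP Pn mn; exists n; last by apply: mn; apply/decbP.
by split=> // k kn /decbP /mn; rewrite leqNgt kn.
Qed.

Lemma nstar_Lstd s om eps d n : admissible_weights om -> admissible d eps ->
  is_nstar Lall s om (eps / 36) d n ->
  exists2 m, is_nstar Lstd s om eps d m & (m <= sample_budget (n.*2.+1))%nat.
Proof.
move=> Hom [d1 [e0 e1]] [Hn _]; have [om0 [M HM]] := Hom d.
have He : 0 < eps / 36 by lra.
have [m mn Hm] : exists2 m, (m <= sample_budget (n.*2.+1))%nat &
    Rbar_le (err Lstd om d m) (Rbar_mult (Finite eps) (CRI s om d)).
  (* [CRI] is an extended real. If it is plus infinity, zero samples suffice; minus infinity would
     contradict the positivity of errors. *)
  move: Hn; case: (CRI s om d) => [c| |] Hn.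
  - have [m mn Hm] := err_Lstd_le d1 om0 HM Hn.
    by exists m => //; rewrite (_ : Rbar_mult eps c = Finite (36 * (eps / 36 * c))) //=; congr Finite; field.
  - exists 0%nat => //; by rewrite Rbar_mult_pos_p_infty //; case: (err _ _ _ _).
  - rewrite Rbar_mult_pos_m_infty // in Hn; exfalso.
    have : Rbar_le (err Lall om d n) (Finite 0) by move: Hn; case: (err _ _ _ _).
    by move=> /(err_Lall_pos d1 om0 HM); lra.
have [m' h1 h2] := is_nstar_exists Hm.
by exists m' => //; apply: leq_trans h2 mn.
Qed.

Lemma nstar_Lall s om eps d n : admissible_weights om ->
  is_nstar Lstd s om eps d n -> exists2 m, is_nstar Lall s om eps d m & (m <= n)%nat.
Proof.
move=> Hom [Hn _]; have [om0 [M HM]] := Hom d.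
by apply: is_nstar_exists; apply: Rbar_le_trans Hn; apply: (err_Lall_le_Lstd om0 HM).
Qed.

(** * Transfer of the tractability notions *)

Lemma ln_0 : ln 0 = 0.
Proof. by rewrite /ln; case: Rlt_dec => // h; exfalso; lra. Qed.

Lemma ln_ge0 x : 1 <= x -> 0 <= ln x.
Proof. by move=> H; rewrite -ln_1; apply: ln_le; lra. Qed.

Lemma ln_INR_ge0 n : 0 <= ln (INR n).
Proof.
case: n => [|n]; first by rewrite /= ln_0; lra.
by apply: ln_ge0; rewrite S_INR; have := pos_INR n; lra.
Qed.

Lemma ln_INR_le m x : INR m <= x -> 1 <= x -> ln (INR m) <= ln x.
Proof.
move=> H x1; case: m H => [|m] H; first by rewrite /= ln_0; apply: ln_ge0.
by apply: ln_le => //; apply: lt_0_INR; lia.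
Qed.

Lemma Rpower_ge1 x p : 1 <= x -> 0 <= p -> 1 <= Rpower x p.
Proof.
by move=> x1 p0; rewrite -(Rpower_O x); [apply: Rle_Rpower; lra|lra].
Qed.

Lemma Rpower_mono x y p : 0 < x <= y -> 0 <= p -> Rpower x p <= Rpower y p.
Proof. by move=> xy p0; apply: Rle_Rpower_l. Qed.

(** The logarithm is absorbed by an arbitrarily small power, from
    [del ln m <= exp (del ln m) = m^del]. Small [del] matters for the exponents alone; the
    tractability notions use [del = 1]. *)
Lemma sample_budget_bound del : 0 < del -> exists A, 1 <= A /\
  forall n, INR (sample_budget n.*2.+1) <= A * Rpower (1 + INR n) (1 + del).
Proof.
move=> d0; have l2 : 0 < ln 2 by have := ln_lt_2; lra.
set B := 1 / (del * ln 2) + 1.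
have B1 : 1 <= B.
  by rewrite /B; have : 0 < 1 / (del * ln 2); [apply: Rdiv_lt_0_compat; nra|lra].
exists (B * Rpower 2 del * 8193).
have P2 := Rpower_ge1 (x := 2) (p := del) ltac:(lra) ltac:(lra).
split=> [|n]; first by nra.
have n0 := pos_INR n; set X := 1 + INR n; have X1 : 1 <= X by rewrite /X; lra.
set m := n.*2.+1.
have Em : INR m = 2 * INR n + 1 by rewrite /m S_INR -addnn plus_INR; ring.
have m0 : 0 < INR m by rewrite Em; lra.
have L : INR (Nat.log2 m) + 1 <= B * Rpower (INR m) del.
  have h : (Nat.pow 2 (Nat.log2 m) <= m)%coq_nat by have [] := Nat.log2_spec m; [rewrite /m; lia|].
  have h1 : INR (Nat.log2 m) * ln 2 <= ln (INR m).
    have p : 0 < (2 : R) ^ Nat.log2 m by apply: pow_lt; lra.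
    rewrite -ln_pow; last lra.
    by apply: ln_le => //; move: (le_INR _ _ h); rewrite pow_INR.
  have h2 : ln (INR m) * del <= Rpower (INR m) del.
    rewrite /Rpower Rmult_comm; have := exp_ineq1_le (del * ln (INR m)); lra.
  have h3 : 1 <= Rpower (INR m) del by apply: Rpower_ge1; lra.
  have h4 : INR (Nat.log2 m) <= 1 / (del * ln 2) * Rpower (INR m) del.
    have dl : del * ln 2 > 0 by nra.
    rewrite (_ : _ * _ = Rpower (INR m) del / (del * ln 2)); last by field; lra.
    by apply: (proj1 (Rle_div_r _ _ _ dl)); nra.
  by rewrite /B; lra.
have L' : Rpower (INR m) del <= Rpower 2 del * Rpower X del.
  rewrite Rpower_mult_distr; try lra.
  by apply: Rpower_mono; [rewrite Em /X; lra|lra].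
have Eb : INR (sample_budget m) = (INR (Nat.log2 m) + 1) * (4 * (1024 * (2 * INR n + 1 + 1)) + 1).
  rewrite /sample_budget mult_INR (S_INR (Nat.log2 m)) (S_INR (4 * _)%nat) mult_INR mult_INR (S_INR m) Em.
  by rewrite (INR_IZR_INZ 1024) (INR_IZR_INZ 4).
rewrite Eb Rpower_plus Rpower_1; last lra.
have hX : 4 * (1024 * (2 * INR n + 1 + 1)) + 1 <= 8193 * X by rewrite /X; lra.
have PX := Rpower_ge1 (x := X) (p := del) X1 ltac:(lra).
have hL : INR (Nat.log2 m) + 1 <= B * (Rpower 2 del * Rpower X del) by nra.
apply: (Rle_trans _ (B * (Rpower 2 del * Rpower X del) * (8193 * X))).
  apply: Rmult_le_compat => //; have := pos_INR (Nat.log2 m); lra.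
by apply: Req_le; ring.
Qed.

(** What the algebraic and the exponential scale share: the loss of [36] in accuracy costs a
    constant factor, and the scale tends to infinity as [eps] tends to [0]. *)
Definition tame (u : R -> R) : Prop :=
  [/\ forall eps, 0 < eps < 1 -> 1 <= u eps,
      exists c, 1 <= c /\ forall eps, 0 < eps < 1 -> u (eps / 36) <= c * u eps &
      forall B, exists K, forall eps, 0 < eps < 1 -> K < / eps -> B <= u eps].

Lemma tame_alg : tame u_alg.
Proof.
split.
- by move=> e e01; rewrite /u_alg -Rinv_1; apply: Rinv_le_contravar; lra.
- exists 36; split; first lra.
  by move=> e e01; rewrite /u_alg; apply: Req_le; field; lra.
- by move=> B; exists B => e _; rewrite /u_alg; lra.
Qed.

Lemma tame_exp : tame u_exp.
Proof.
have inv1 e : 0 < e < 1 -> 1 <= / e by move=> h; rewrite -Rinv_1; apply: Rinv_le_contravar; lra.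
split.
- by move=> e e01; rewrite /u_exp; have := ln_ge0 (inv1 e e01); lra.
- have l36 : 0 <= ln 36 by apply: ln_ge0; lra.
  exists (1 + ln 36); split; first lra.
  move=> e e01; have e1 := inv1 e e01; rewrite /u_exp (_ : / (e / 36) = 36 * / e); last by field; lra.
  by rewrite ln_mult; [have := ln_ge0 e1; nra|lra|lra].
- move=> B; exists (exp B) => e e01 H; rewrite /u_exp.
  have : ln (exp B) <= ln (/ e) by apply: ln_le; [exact: exp_pos|lra].
  rewrite ln_exp; lra.
Qed.

Section Transfer.
Context (om : weights) (s : setting) (Hom : admissible_weights om).

Lemma ln_nstar_small_ext u v Lam : (forall eps d, admissible d eps -> u eps d = v eps d) ->
  ln_nstar_small Lam s om u -> ln_nstar_small Lam s om v.
Proof.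
by move=> E H del d0; have [K HK] := H del d0; exists K => d e ad /(HK d e ad) [n [h1 h2]];
  exists n; rewrite -E.
Qed.

Lemma admissible_36 d eps : admissible d eps -> admissible d (eps / 36).
Proof. by move=> [h1 h2]; split=> //; lra. Qed.

Lemma INR_d_ge1 d eps : admissible d eps -> 1 <= INR d.
Proof. by move=> [/leP /le_INR h _]. Qed.

Lemma ln_nstar_small_down g : ln_nstar_small Lstd s om g -> ln_nstar_small Lall s om g.
Proof.
move=> H del d0; have [K HK] := H del d0; exists K => d e ad /(HK d e ad) [n [hn ln_n]].
have [m hm /leP mn] := nstar_Lall Hom hn.
exists m; split=> //; apply: Rle_trans ln_n.
case: m mn {hm} => [|m] mn; first by rewrite /= ln_0; apply: ln_INR_ge0.
by apply: ln_le; [apply: lt_0_INR; lia|apply: le_INR].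
Qed.

(** [ln m <= ln A + 2 ln 2 + 2 ln n]. Half of [del] pays for the constant, because [g] tends to
    infinity, and half for the term in [ln n], with [c] compensating the passage to [eps / 36]. *)
Lemma ln_nstar_small_up g : (exists c, 0 < c /\ forall eps d, admissible d eps -> g (eps / 36) d <= c * g eps d) ->
  (forall B, exists K, forall eps d, admissible d eps -> K < / eps + INR d -> B <= g eps d) ->
  ln_nstar_small Lall s om g -> ln_nstar_small Lstd s om g.
Proof.
move=> [c [c0 Hc]] Hg H del d0.
have [A [A1 HA]] := sample_budget_bound Rlt_0_1.
have d4 : 0 < del / (4 * c) by apply: Rdiv_lt_0_compat; lra.
have [K1 H1] := H _ d4.
have [K2 H2] := Hg ((ln A + 2 * ln 2) * (2 / del)).
exists (Rmax K1 K2) => d e ad HK; have [d1 e01] := ad.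
have ie : 0 < / e by apply: Rinv_0_lt_compat; lra.
have [|n [hn hl]] := H1 d (e / 36) (admissible_36 ad).
  rewrite (_ : / (e / 36) = 36 * / e); last by field; lra.
  by have := Rmax_l K1 K2; lra.
have [m hm /leP /le_INR mn] := nstar_Lstd Hom ad hn.
exists m; split=> //.
have gB := H2 e d ad (Rle_lt_trans _ _ _ (Rmax_r K1 K2) HK).
have n0 := pos_INR n; have X1 : 1 <= 1 + INR n by lra.
have P1 : 1 <= Rpower (1 + INR n) (1 + 1) by apply: Rpower_ge1; lra.
have l1 : ln (INR m) <= ln A + 2 * ln (1 + INR n).
  apply: (Rle_trans _ (ln (A * Rpower (1 + INR n) (1 + 1)))).
    by apply: ln_INR_le; [apply: Rle_trans mn (HA n)|nra].
  by rewrite ln_mult ?ln_Rpower; lra.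
(* At [n = 0] this rests on the convention [ln 0 = 0]. *)
have l2 : ln (1 + INR n) <= ln 2 + ln (INR n).
  case: (n) => [|k]; first by rewrite /= ln_0 Rplus_0_r ln_1; have := ln_lt_2; lra.
  have k0 := pos_INR k; rewrite -ln_mult; try (rewrite ?S_INR; lra).
  by apply: ln_le; rewrite S_INR; lra.
have l3 : del / (4 * c) * g (e / 36) d <= del / 4 * g e d.
  have := Hc e d ad; rewrite (_ : del / 4 * g e d = del / (4 * c) * (c * g e d)); last by field; lra.
  nra.
have : ln A + 2 * ln 2 <= del / 2 * g e d.
  rewrite (_ : ln A + 2 * ln 2 = del / 2 * ((ln A + 2 * ln 2) * (2 / del))); last by field; lra.
  apply: Rmult_le_compat_l gB; lra.
lra.
Qed.

Context (u : R -> R) (Hu : tame u).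

Lemma SPT_with_down p : SPT_with u Lstd s om p -> SPT_with u Lall s om p.
Proof.
move=> [C [C0 H]]; exists C; split=> // d e ad; have [n [hn ln]] := H d e ad.
have [m hm /leP /le_INR mn] := nstar_Lall Hom hn; exists m; split=> //; lra.
Qed.

(** Since [1 + n] is at most [D] times the [p]-th power of the scale, the budget inflates the
    exponent only by [1 + del], and the infimum in [pstar] removes this factor. *)
Lemma SPT_with_up p del : 0 <= p -> 0 < del ->
  SPT_with u Lall s om p -> SPT_with u Lstd s om (p * (1 + del)).
Proof.
move=> p0 d0 [C [C0 H]]; have [u1 [c [c1 uc]] _] := Hu.
have [A [A1 HA]] := sample_budget_bound d0.
set D := 1 + C * Rpower c p; have cp := Rpower_ge1 c1 p0.
have D1 : 1 <= D by rewrite /D; nra.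
exists (A * Rpower D (1 + del)); split.
  by have : 1 <= Rpower D (1 + del) by [apply: Rpower_ge1; lra]; nra.
move=> d e ad; have [d1 e01] := ad; have ue := u1 e e01.
have [n [hn ln]] := H d (e / 36) (admissible_36 ad).
have [m hm /leP /le_INR mn] := nstar_Lstd Hom ad hn.
exists m; split=> //; apply: Rle_trans mn _; apply: Rle_trans (HA n) _.
rewrite Rmult_assoc; apply: Rmult_le_compat_l; first lra.
have up := Rpower_ge1 ue p0; have n0 := pos_INR n.
have u36 := u1 (e / 36) (proj2 (admissible_36 ad)).
have Xn : 1 + INR n <= D * Rpower (u e) p.
  have : Rpower (u (e / 36)) p <= Rpower c p * Rpower (u e) p.
    rewrite Rpower_mult_distr; try lra.
    by apply: Rpower_mono => //; have := uc e e01; lra.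
  rewrite /D; nra.
apply: (Rle_trans _ (Rpower (D * Rpower (u e) p) (1 + del))); first by apply: Rpower_mono; lra.
by rewrite -Rpower_mult_distr ?Rpower_mult; lra.
Qed.

Lemma SPT_iff : SPT u Lall s om <-> SPT u Lstd s om.
Proof.
split=> -[p [p0 H]]; last by exists p; split=> //; apply: SPT_with_down.
exists (p * (1 + 1)); split; first lra.
exact: SPT_with_up Rlt_0_1 H.
Qed.

Lemma pstar_eq : pstar u Lall s om = pstar u Lstd s om.
Proof.
apply: Rbar_le_antisym.
  have [lb _] := Glb_Rbar_correct (fun p => 0 <= p /\ SPT_with u Lall s om p).
  have [_ glb] := Glb_Rbar_correct (fun p => 0 <= p /\ SPT_with u Lstd s om p).
  by apply: glb => p [p0 /SPT_with_down H]; apply: lb.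
have [lb _] := Glb_Rbar_correct (fun p => 0 <= p /\ SPT_with u Lstd s om p).
have [_ glb] := Glb_Rbar_correct (fun p => 0 <= p /\ SPT_with u Lall s om p).
apply: glb => p [p0 H].
have L del : 0 < del -> Rbar_le (pstar u Lstd s om) (p * (1 + del)).
  by move=> d0; apply: lb; split; [nra|apply: SPT_with_up].
move: L; rewrite -/(pstar u Lstd s om); case: (pstar u Lstd s om) => [g| |] L //; last exact: (L 1 Rlt_0_1).
apply: le_epsilon => e e0; have q0 : 0 < p + 1 by lra.
have := L (e / (p + 1)) (Rdiv_lt_0_compat _ _ e0 q0); rewrite /=.
have : p * (e / (p + 1)) <= e.
  have : e = (p + 1) * (e / (p + 1)) by field; lra.
  have : 0 < e / (p + 1) by apply: Rdiv_lt_0_compat.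
  nra.
lra.
Qed.

Lemma PT_iff : PT u Lall s om <-> PT u Lstd s om.
Proof.
have [u1 [c [c1 uc]] _] := Hu; split=> -[C [p [q [C0 [p0 [q0 H]]]]]]; last first.
  exists C, p, q; do 3 split=> //; move=> d e ad; have [n [hn ln]] := H d e ad.
  have [m hm /leP /le_INR mn] := nstar_Lall Hom hn; exists m; split=> //; lra.
have [A [A1 HA]] := sample_budget_bound Rlt_0_1.
set D := 1 + C * Rpower c p; have cp := Rpower_ge1 c1 p0.
have D1 : 1 <= D by rewrite /D; nra.
have P1 : 1 <= Rpower D (1 + 1) by apply: Rpower_ge1; lra.
exists (A * Rpower D (1 + 1)), (p * (1 + 1)), (q * (1 + 1)).
split; first by nra.
do 2 (split; first lra).
move=> d e ad; have [d1 e01] := ad; have ue := u1 e e01; have dd := INR_d_ge1 ad.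
have [n [hn ln]] := H d (e / 36) (admissible_36 ad).
have [m hm /leP /le_INR mn] := nstar_Lstd Hom ad hn.
exists m; split=> //; apply: Rle_trans mn _; apply: Rle_trans (HA n) _.
rewrite !Rmult_assoc; apply: Rmult_le_compat_l; first lra.
have up := Rpower_ge1 ue p0; have dq := Rpower_ge1 dd q0; have n0 := pos_INR n.
have u36 := u1 (e / 36) (proj2 (admissible_36 ad)).
have Xn : 1 + INR n <= D * (Rpower (INR d) q * Rpower (u e) p).
  have h : Rpower (u (e / 36)) p <= Rpower c p * Rpower (u e) p.
    rewrite Rpower_mult_distr; try lra.
    by apply: Rpower_mono => //; have := uc e e01; lra.
  have h1 : INR n <= C * Rpower (INR d) q * (Rpower c p * Rpower (u e) p).
    apply: Rle_trans ln _; apply: Rmult_le_compat_l => //; nra.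
  have h2 : 1 <= Rpower (INR d) q * Rpower (u e) p by nra.
  rewrite /D; lra.
have g0 : 0 < Rpower (INR d) q * Rpower (u e) p by nra.
apply: (Rle_trans _ (Rpower (D * (Rpower (INR d) q * Rpower (u e) p)) (1 + 1))); first by apply: Rpower_mono; lra.
by rewrite -!Rpower_mult_distr ?Rpower_mult; lra.
Qed.

Lemma QPT_iff : QPT u Lall s om <-> QPT u Lstd s om.
Proof.
have [u1 [c [c1 uc]] _] := Hu; split=> -[C [t [C0 [t0 H]]]]; last first.
  exists C, t; do 2 split=> //; move=> d e ad; have [n [hn ln]] := H d e ad.
  have [m hm /leP /le_INR mn] := nstar_Lall Hom hn; exists m; split=> //; lra.
have [A [A1 HA]] := sample_budget_bound Rlt_0_1.
have lc := ln_ge0 c1.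
have P1 : 1 <= Rpower (1 + C) (1 + 1) by apply: Rpower_ge1; lra.
(* [1 + ln (c u) <= (1 + ln c) (1 + ln u)] accounts for [1 + ln c]; the factor [1 + 1] is the
   exponent of the budget. *)
exists (A * Rpower (1 + C) (1 + 1)), (t * (1 + ln c) * (1 + 1)).
split; first by nra.
split; first by nra.
move=> d e ad; have [d1 e01] := ad; have ue := u1 e e01; have dd := INR_d_ge1 ad.
have [n [hn ln_n]] := H d (e / 36) (admissible_36 ad).
have [m hm /leP /le_INR mn] := nstar_Lstd Hom ad hn.
exists m; split=> //; apply: Rle_trans mn _; apply: Rle_trans (HA n) _.
rewrite !Rmult_assoc; apply: Rmult_le_compat_l; first lra.
have u36 := u1 (e / 36) (proj2 (admissible_36 ad)); have n0 := pos_INR n.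
have lu := ln_ge0 ue; have ld := ln_ge0 dd.
set w := t * ((1 + ln c) * ((1 + ln (INR d)) * (1 + ln (u e)))).
have w0 : 0 <= w by rewrite /w; repeat apply: Rmult_le_pos; lra.
have ew : 1 <= exp w by have := exp_ineq1_le w; lra.
have Xn : 1 + INR n <= (1 + C) * exp w.
  have h : t * (1 + ln (INR d)) * (1 + ln (u (e / 36))) <= w.
    have : ln (u (e / 36)) <= ln c + ln (u e).
      by rewrite -ln_mult; [apply: ln_le; [lra|exact: uc]|lra|lra].
    move=> h; have h' : 1 + ln (u (e / 36)) <= (1 + ln c) * (1 + ln (u e)) by nra.
    apply: (Rle_trans _ (t * (1 + ln (INR d)) * ((1 + ln c) * (1 + ln (u e))))).
      by apply: Rmult_le_compat_l => //; nra.
    by rewrite /w; apply: Req_le; ring.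
  have : exp (t * (1 + ln (INR d)) * (1 + ln (u (e / 36)))) <= exp w.
    by case: h => [h|->]; [apply: Rlt_le; apply: exp_increasing|lra].
  nra.
apply: (Rle_trans _ (Rpower ((1 + C) * exp w) (1 + 1))); first by apply: Rpower_mono; lra.
rewrite -Rpower_mult_distr; try lra.
apply: Rmult_le_compat_l; first lra.
rewrite {1}/Rpower ln_exp; apply: Req_le; congr exp; rewrite /w; ring.
Qed.

Lemma stWT_iff sp tp : 0 < sp -> 0 < tp -> stWT u Lall s om sp tp <-> stWT u Lstd s om sp tp.
Proof.
move=> sp0 tp0; split; last exact: ln_nstar_small_down.
have [u1 [c [c1 uc]] ug] := Hu.
have cs := Rpower_ge1 c1 (Rlt_le _ _ sp0).
apply: ln_nstar_small_up.
  exists (Rpower c sp); split; first lra.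
  move=> e d ad; have [d1 e01] := ad; have ue := u1 e e01.
  have u36 := u1 (e / 36) (proj2 (admissible_36 ad)).
  have h : Rpower (u (e / 36)) sp <= Rpower c sp * Rpower (u e) sp.
    rewrite Rpower_mult_distr; try lra.
    by apply: Rpower_mono; [have := uc e e01; lra|lra].
  have := Rpower_ge1 (INR_d_ge1 ad) (Rlt_le _ _ tp0); nra.
move=> B; set B1 := Rmax B 1; have B11 : 1 <= B1 by apply: Rmax_r.
have BB : B <= B1 by apply: Rmax_l.
have inv p x : 0 < p -> Rpower B1 (/ p) <= x -> B <= Rpower x p.
  move=> p0 hx; apply: (Rle_trans _ _ _ BB).
  rewrite -{1}(Rpower_1 B1); last lra.
  rewrite -(Rinv_l p); last lra.
  rewrite -Rpower_mult; apply: Rpower_mono; last lra.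
  by split=> //; apply: exp_pos.
have [K HK] := ug (Rpower B1 (/ sp)).
(* If [d] is below the second summand, the first one forces [/ eps > K]; so one of the two powers
   always reaches [B]. *)
exists (Rmax K 0 + Rpower B1 (/ tp)) => e d ad h; have [d1 e01] := ad.
have ue := Rpower_ge1 (u1 e e01) (Rlt_le _ _ sp0).
have dd := Rpower_ge1 (INR_d_ge1 ad) (Rlt_le _ _ tp0).
case: (Rle_or_lt (Rpower B1 (/ tp)) (INR d)) => hd; first by have := inv tp (INR d) tp0 hd; lra.
have := inv sp (u e) sp0; have := HK e e01; have := Rmax_l K 0 => h1 h2 h3.
have := h3 (h2 ltac:(lra)); lra.
Qed.

Lemma WT_iff : WT u Lall s om <-> WT u Lstd s om.
Proof.
have [u1 _ _] := Hu.
have E e d : admissible d e -> Rpower (u e) 1 + Rpower (INR d) 1 = u e + INR d.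
  move=> ad; rewrite !Rpower_1 //; first by have := INR_d_ge1 ad; lra.
  by have := u1 e (proj2 ad); lra.
have H := stWT_iff Rlt_0_1 Rlt_0_1.
split=> h; apply: (ln_nstar_small_ext E); apply H.
  exact: (ln_nstar_small_ext (fun e d ad => esym (E e d ad)) h).
exact: (ln_nstar_small_ext (fun e d ad => esym (E e d ad)) h).
Qed.

Lemma UWT_iff : UWT u Lall s om <-> UWT u Lstd s om.
Proof.
by split=> H al be a0 b0; [apply: (proj1 (stWT_iff a0 b0))|apply: (proj2 (stWT_iff a0 b0))]; apply: H.
Qed.

End Transfer.

Theorem theorem2p4 (om : weights) (s : setting) :
  admissible_weights om ->
  (* (i) ALG notions *)
  ((SPT u_alg Lall s om <-> SPT u_alg Lstd s om) /\
   (PT u_alg Lall s om <-> PT u_alg Lstd s om) /\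
   (QPT u_alg Lall s om <-> QPT u_alg Lstd s om) /\
   (WT u_alg Lall s om <-> WT u_alg Lstd s om) /\
   (forall sp tp : R, (0 < sp)%R -> (0 < tp)%R ->
      (stWT u_alg Lall s om sp tp <-> stWT u_alg Lstd s om sp tp)) /\
   (UWT u_alg Lall s om <-> UWT u_alg Lstd s om)) /\
  (* (ii) EXP notions *)
  ((SPT u_exp Lall s om <-> SPT u_exp Lstd s om) /\
   (PT u_exp Lall s om <-> PT u_exp Lstd s om) /\
   (QPT u_exp Lall s om <-> QPT u_exp Lstd s om) /\
   (WT u_exp Lall s om <-> WT u_exp Lstd s om) /\
   (forall sp tp : R, (0 < sp)%R -> (0 < tp)%R ->
      (stWT u_exp Lall s om sp tp <-> stWT u_exp Lstd s om sp tp)) /\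
   (UWT u_exp Lall s om <-> UWT u_exp Lstd s om)) /\
  (* (iii) exponents of SPT *)
  (pstar u_alg Lall s om = pstar u_alg Lstd s om /\
   pstar u_exp Lall s om = pstar u_exp Lstd s om).
Proof.
move=> Hom; have ta := tame_alg; have te := tame_exp.
split; [|split]; last by split; apply: pstar_eq.
  do 5 (split; first by [apply: SPT_iff|apply: PT_iff|apply: QPT_iff|apply: WT_iff|move=> sp tp; apply: stWT_iff]).
  exact: UWT_iff.
do 5 (split; first by [apply: SPT_iff|apply: PT_iff|apply: QPT_iff|apply: WT_iff|move=> sp tp; apply: stWT_iff]).
exact: UWT_iff.
Qed.
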